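(* Let $K\ne 2^{[m]}$ be a simplicial complex on $[m]$ and let $K^\vee$ be its Alexander dual. Then the cubical complex $Z(K,K^\vee)$ is a cubulation of an $(m-1)$-dimensional disc $D^{m-1}$, while its boundary $\partial Z(K,K^\vee)$ is the canonical cubulation of the Bier sphere $B(K,K^\vee)=\mathrm{Bier}(K)$. More explicitly: (i) the complex $Z(K,K^\vee)$ is precisely the cubical complex $\mathcal C=\{C_\tau : \tau\in \mathrm{Bier}(K)\}$ consisting of the cubes $C_\tau$ associated to the simplices of the standard geometric realization of $\mathrm{Bier}(K)$; (ii) $\partial Z(K,K^\vee)$ is precisely the canonical ($\widehat S$-frontal) cubulation $B(K,K^\vee)_{cubic}$ of the Bier sphere, i.e. the cubical complex formed by the front complexes $\mathrm{Front}(C_\tau)$, $\tau\in\mathrm{Bier}(K)$, which is identified with the geometric realization of $\mathrm{Bier}(K)$ via the maps $i_c$.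
   Context: $[m]=\{1,\dots,m\}$, $[m']=\{1',\dots,m'\}$, $I'=\{i':i\in I\}$. A simplicial complex on $[m]$ is a collection of subsets containing $\varnothing$ and closed under taking subsets. The Alexander dual of $K\neq 2^{[m]}$ is $K^\vee=\{J' : J\subseteq[m],\ [m]\setminus J\notin K\}$ on $[m']$ (identified with $[m]$ when convenient), and the Bier sphere is $\mathrm{Bier}(K)=B(K,K^\vee)=\{I\sqcup J' : I\in K, J'\in K^\vee, I\cap J=\varnothing\}$, an $(m-2)$-dimensional triangulated sphere. Polyhedral product: for a pair of spaces $(X,A)$, $\mathcal Z_K(X,A)=\bigcup_{\sigma\in K}\big(\prod_{i\in\sigma}X\times\prod_{j\notin\sigma}A\big)\subseteq X^m$. With $J=[-1,1]$, $J_{\leqslant 0}=[-1,0]$, $J_{\geqslant 0}=[0,1]$, put $$Z(K,K^\vee)=\mathcal Z_K(J,J_{\leqslant 0})\cap\mathcal Z_{K^\vee}(J,J_{\geqslant 0})\subseteq[-1,1]^m,$$ a cubical subcomplex of the cube $[-1,1]^m$ subdivided by the coordinate hyperplanes into $2^m$ unit cubes. $\partial Z(K,K^\vee)$ denotes its boundary (as a disc). Standard geometric realization of $\mathrm{Bier}(K)$: the vertex $i\in[m]$ is realized by $v_i=e_i\in\mathbb R^m$ and the vertex $j'\in[m']$ by $v_{j'}=-e_j$, and the simplex $\tau\in\mathrm{Bier}(K)$ by $\mathrm{conv}\{v_s : s\in\tau\}$. To each simplex $\tau$ one associates the cube given by the Minkowski sum $C_\tau=\sum_{s\in\tau}[0,v_s]$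 (with $C_\varnothing=\{0\}$). $\mathrm{Front}(C_\tau)$ is the union of all facets of $C_\tau$ containing the vertex $\sum_{s\in\tau}v_s$ (a cubical complex). The map $i_c$ from the simplex $\mathrm{conv}\{v_s:s\in\tau\}$ to $\mathrm{Front}(C_\tau)$ is the piecewise linear homeomorphism that sends the barycenter $\frac1{|I|}\sum_{s\in I}v_s$ of each nonempty face $I\subseteq\tau$ to the vertex $\sum_{s\in I}v_s$ and is affine on each simplex of the barycentric subdivision. The cubical structures on the simplices $\tau$ pulled back by the maps $i_c$ fit together to a cubical structure on the realization of $\mathrm{Bier}(K)$; this is the canonical ($\widehat S$-frontal) cubulation $B(K,K^\vee)_{cubic}$. *)

(* Defs.v *)
From HB Require Import structures.
From mathcomp Require Import all_boot all_order all_algebra.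
From mathcomp Require Import all_classical all_reals all_analysis.
Import numFieldNormedType.Exports.
Import Order.TTheory GRing.Theory Num.Theory.

Set Implicit Arguments.
Unset Strict Implicit.
Unset Printing Implicit Defensive.

Local Open Scope classical_set_scope.
Local Open Scope ring_scope.

(* Ghost vertices are allowed: singletons need not belong to K. *)
Definition simplicial_complex (m : nat) (K : {set {set 'I_m}}) : Prop :=
  finset.set0 \in K /\
  forall I J : {set 'I_m}, I \in K -> J \subset I -> J \in K.

(* The vertex set [m'] is identified with [m]. *)
Definition alexander_dual (m : nat) (K : {set {set 'I_m}}) : {set {set 'I_m}} :=
  [set J : {set 'I_m} | (~: J)%SET \notin K]%SET.

(* [inl i] is the vertex i of [m] and [inr j] is the vertex j' of [m']. *)
Definition Bier (m : nat) (K : {set {set 'I_m}}) : {set {set 'I_m + 'I_m}} :=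
  [set (inl @: I :|: inr @: J)%SET | I : {set _} in K,
     J : {set _} in alexander_dual K & [disjoint I & J]]%SET.

Definition polyhedral_product (R : realType) (m : nat) (K : {set {set 'I_m}})
    (X A : set R) : set 'rV[R]_m :=
  \bigcup_(s in [set s : {set 'I_m} | s \in K])
    [set x : 'rV[R]_m | forall i, (if i \in s then X else A) (x ord0 i)].

Definition Zset (R : realType) (m : nat) (K : {set {set 'I_m}}) :
    set 'rV[R]_m :=
  polyhedral_product K `[-1, 1] `[-1, 0]
  `&` polyhedral_product (alexander_dual K) `[-1, 1] `[0, 1].
Arguments Zset R {m} K.

(* The nonempty faces of a polytope P, including P itself: the loci where
   linear functionals attain their maximum on P. *)
Definition is_face (R : realType) (m : nat) (P F : set 'rV[R]_m) : Prop :=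
  F !=set0 /\
  exists l : {scalar 'rV[R]_m},
    F = [set x | P x /\ forall y, P y -> l y <= l x].

Definition is_facet (R : realType) (m : nat) (P F : set 'rV[R]_m) : Prop :=
  [/\ is_face P F, F <> P &
      forall G, is_face P G -> F `<=` G -> G = F \/ G = P].

(* A k-dimensional parallelepiped with linearly independent edge directions,
   the rows of w. *)
Definition is_cube (R : realType) (m : nat) (Q : set 'rV[R]_m) : Prop :=
  exists (k : nat) (p : 'rV[R]_m) (w : 'M[R]_(k, m)),
    row_free w /\
    Q = [set p + t *m w | t in [set t : 'rV[R]_k | forall i, 0 <= t ord0 i <= 1]].

Definition cubical_complex (R : realType) (m : nat)
    (C : set (set 'rV[R]_m)) : Prop :=
  [/\ finite_set C,
      (forall Q, C Q -> is_cube Q),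
      (forall Q F, C Q -> is_face Q F -> C F) &
      (forall P Q, C P -> C Q ->
         P `&` Q = set0 \/ (is_face P (P `&` Q) /\ is_face Q (P `&` Q)))].

Definition cubulation (R : realType) (m : nat)
    (C : set (set 'rV[R]_m)) (X : set 'rV[R]_m) : Prop :=
  cubical_complex C /\ \bigcup_(Q in C) Q = X.

(* One of the 2^m unit cubes cut out of [-1, 1]^m by the coordinate
   hyperplanes. *)
Definition unit_cube (R : realType) (m : nat) (A : {set 'I_m}) :
    set 'rV[R]_m :=
  [set x | forall i, if i \in A then 0 <= x ord0 i <= 1
                     else -1 <= x ord0 i <= 0].
Arguments unit_cube R {m} A.

Definition grid_cell (R : realType) (m : nat) (Q : set 'rV[R]_m) : Prop :=
  exists A : {set 'I_m}, is_face (unit_cube R A) Q.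

(* The largest subcomplex of the subdivided cube supported in X. *)
Definition grid_subcomplex (R : realType) (m : nat) (X : set 'rV[R]_m) :
    set (set 'rV[R]_m) :=
  [set Q | grid_cell Q /\ Q `<=` X].

(* Maps between subspaces are represented by total functions, of which only
   the restrictions matter. *)
Definition homeo_on (X Y : topologicalType) (A : set X) (B : set Y)
    (f : X -> Y) : Prop :=
  [/\ set_bij A B f, {within A, continuous f} &
      exists g : Y -> X, {within B, continuous g} /\
        (forall x, A x -> g (f x) = x)].

Definition std_disc (R : realType) (d : nat) : set 'rV[R]_d :=
  [set x | \sum_(i < d) x ord0 i ^+ 2 <= 1].
Arguments std_disc R d : clear implicits.

Definition std_sphere (R : realType) (d : nat) : set 'rV[R]_d :=
  [set x | \sum_(i < d) x ord0 i ^+ 2 = 1].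
Arguments std_sphere R d : clear implicits.

(* Z is a d-dimensional disc with boundary sphere dZ.  By invariance of
   domain dZ is determined by Z and does not depend on the choice of h. *)
Definition disc_with_boundary (R : realType) (d m : nat)
    (Z dZ : set 'rV[R]_m) : Prop :=
  exists h : 'rV[R]_d -> 'rV[R]_m,
    homeo_on (std_disc R d) Z h /\ h @` std_sphere R d = dZ.

Definition vtx (R : realType) (m : nat) (s : 'I_m + 'I_m) : 'rV[R]_m :=
  match s with
  | inl i => delta_mx ord0 i
  | inr j => - delta_mx ord0 j
  end.
Arguments vtx R {m} s.

Definition hull (R : realType) (m : nat) (T : finType) (A : {set T})
    (p : T -> 'rV[R]_m) : set 'rV[R]_m :=
  [set \sum_(t in A) c t *: p t | c in
     [set c : T -> R | (forall t, t \in A -> 0 <= c t) /\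
                       \sum_(t in A) c t = 1]].

Definition realization (R : realType) (m : nat) (B : {set {set 'I_m + 'I_m}}) :
    set 'rV[R]_m :=
  \bigcup_(tau in [set tau : {set 'I_m + 'I_m} | tau \in B])
    hull tau (@vtx R m).
Arguments realization R {m} B.

Definition segment0 (R : realType) (m : nat) (v : 'rV[R]_m) : set 'rV[R]_m :=
  [set t *: v | t in `[0, 1] : set R].

Definition cube_of (R : realType) (m : nat) (tau : {set 'I_m + 'I_m}) :
    set 'rV[R]_m :=
  [set \sum_(s in tau) x s | x in
     [set x : 'I_m + 'I_m -> 'rV[R]_m |
        forall s, s \in tau -> segment0 (vtx R s) (x s)]].
Arguments cube_of R {m} tau.

Definition apex (R : realType) (m : nat) (tau : {set 'I_m + 'I_m}) :
    'rV[R]_m :=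
  \sum_(s in tau) vtx R s.
Arguments apex R {m} tau.

Definition barycenter (R : realType) (m : nat) (tau : {set 'I_m + 'I_m}) :
    'rV[R]_m :=
  (#|tau|%:R)^-1 *: \sum_(s in tau) vtx R s.
Arguments barycenter R {m} tau.

Definition front_complex (R : realType) (m : nat) (tau : {set 'I_m + 'I_m}) :
    set (set 'rV[R]_m) :=
  [set Q | exists F, [/\ is_facet (cube_of R tau) F, F (apex R tau) &
                         is_face F Q]].
Arguments front_complex R {m} tau.

Definition Front (R : realType) (m : nat) (tau : {set 'I_m + 'I_m}) :
    set 'rV[R]_m :=
  \bigcup_(F in [set F | is_facet (cube_of R tau) F /\ F (apex R tau)]) F.
Arguments Front R {m} tau.

Definition affine_on (R : realType) (m : nat) (A : set 'rV[R]_m)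
    (f : 'rV[R]_m -> 'rV[R]_m) : Prop :=
  forall x y (t : R), A x -> A y -> 0 <= t <= 1 ->
    f ((1 - t) *: x + t *: y) = (1 - t) *: f x + t *: f y.

(* A flag of nonempty faces of tau, i.e. a simplex of the barycentric
   subdivision of tau. *)
Definition flag (m : nat) (tau : {set 'I_m + 'I_m})
    (c : {set {set 'I_m + 'I_m}}) : Prop :=
  (forall I, I \in c -> I != finset.set0 /\ I \subset tau) /\
  (forall I J, I \in c -> J \in c -> (I \subset J) || (J \subset I)).

(* f restricts to the map i_c on the simplex conv {v_s : s \in tau}. *)
Definition frontal_map (R : realType) (m : nat) (tau : {set 'I_m + 'I_m})
    (f : 'rV[R]_m -> 'rV[R]_m) : Prop :=
  (forall I : {set 'I_m + 'I_m}, I != finset.set0 -> I \subset tau ->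
     f (barycenter R I) = apex R I) /\
  (forall c, flag tau c -> affine_on (hull c (@barycenter R m)) f).

Definition canonical_map (R : realType) (m : nat) (K : {set {set 'I_m}})
    (f : 'rV[R]_m -> 'rV[R]_m) : Prop :=
  forall tau, tau \in Bier K -> frontal_map tau f.

(* The cells of the fronts of the simplices, pulled back along i_c = f to the
   realization of Bier(K). *)
Definition canonical_cubulation (R : realType) (m : nat)
    (K : {set {set 'I_m}}) (f : 'rV[R]_m -> 'rV[R]_m) : set (set 'rV[R]_m) :=
  [set P | exists tau Q, [/\ tau \in Bier K, front_complex R tau Q &
                             P = hull tau (@vtx R m) `&` f @^-1` Q]].

(* Main.v *)
(* Let supp x record the signs of the coordinates of x, as a set of vertices of
   [m] and [m'].  The cube C_tau, its front and the simplex tau are the sets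
   supp x \subset tau cut out by |x|_oo <= 1, |x|_oo = 1 and |x|_1 = 1, so all
   three complexes live on the fan X of the x with supp x in Bier(K).
   By the definition of the Alexander dual, y - t (1, ..., 1) lies in X exactly
   when {i : y_i > t} is in K and {i : y_i >= t} is not.  There is exactly one
   such t for each y, and it is 1-Lipschitz in y since it is monotone and
   commutes with translations along (1, ..., 1).  Hence X is homeomorphic to
   R^m / (1, ..., 1) = R^(m-1) by a positively homogeneous map, and a radial
   rescaling makes the unit ball of X, which is Z(K, K^v), a disc bounded by
   its unit sphere.
   On the simplices i_c is x_i |-> sgn(x_i) \sum_j min(|x_i|, |x_j|), which is
   a continuous bijection of R^m; compactness of the realization makes it a
   homeomorphism onto the unit sphere of X. *)
From HB Require Import structures.
Require Import Defs.
From mathcomp Require Import all_boot all_order all_algebra.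
From mathcomp Require Import all_classical all_reals all_analysis.
From mathcomp Require Import lra.
Import numFieldNormedType.Exports.
Import Order.TTheory GRing.Theory Num.Theory.

Set Implicit Arguments.
Unset Strict Implicit.
Unset Printing Implicit Defensive.

Local Open Scope classical_set_scope.
Local Open Scope ring_scope.

(** * Boxes and grid cells *)

(** Faces and facets are defined by linear functionals, but every cell that occurs is a box whose
    sides are among [-1,-1], [-1,0], [0,0], [0,1] and [1,1]. A face of a box is a free choice, in
    each coordinate, of the whole side or one of its ends, so the statements about cubes become case
    checks on a single interval. The obstacle in (ii) is that i_c is specified only by its values at
    barycenters and by affinity on flags. The closed formula meets this specification because the
    order of the absolute values of the coordinates is fixed along a flag, which makes every minimum
    a fixed coordinate up to sign. Conversely, every point of a simplex lies in the hull of some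
    flag, so any map that meets the specification agrees with the formula on the realization. As the
    formula is one map on all of R^m, nothing has to be glued along common faces of simplices. *)

Definition box (R : realType) (m : nat) (a b : 'I_m -> R) : set 'rV[R]_m :=
  [set x | forall i, a i <= x ord0 i <= b i].

Variant side (R : realType) (a b : R) : R -> R -> Prop :=
| side_all : side a b a b
| side_lo : side a b a a
| side_hi : side a b b b.

Variant grid_side (R : realType) : R -> R -> Prop :=
| grid_neg : grid_side (-1) (-1)
| grid_neg0 : grid_side (-1) 0
| grid_0 : grid_side 0 0
| grid_0pos : grid_side 0 1
| grid_pos : grid_side 1 1.

Definition dotp (R : realType) (m : nat) (w : 'I_m -> R) (x : 'rV[R]_m) : R :=
  \sum_i x ord0 i * w i.

Lemma dotp_is_linear (R : realType) (m : nat) (w : 'I_m -> R) :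
  linear_for *%R (dotp w).
Proof.
move=> c x y; rewrite /dotp mulr_sumr -big_split /=; apply: eq_bigr => i _.
by rewrite !mxE mulrDl mulrA.
Qed.

HB.instance Definition _ (R : realType) (m : nat) (w : 'I_m -> R) :=
  GRing.isLinear.Build R 'rV[R]_m R *%R (dotp w) (dotp_is_linear w).

Lemma scalarE (R : realType) (m : nat) (l : {scalar 'rV[R]_m}) (x : 'rV[R]_m) :
  l x = dotp (fun i => l (delta_mx ord0 i) : R) x.
Proof.
rewrite {1}(row_sum_delta x) linear_sum; apply: eq_bigr => i _.
by rewrite linearZ.
Qed.

(** The functional is a sum over coordinates, so it can be maximized one coordinate at a time, and
    the sign of [w i] selects the end of side [i]. *)
Lemma box_argmax (R : realType) (m : nat) (a b w : 'I_m -> R) :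
  (forall i, a i <= b i) ->
  [set x | box a b x /\ forall y, box a b y -> dotp w y <= dotp w x] =
  box (fun i => if 0 < w i then b i else a i)
      (fun i => if w i < 0 then a i else b i).
Proof.
move=> ab; apply/seteqP; split=> x /=.
- move=> [xB xmax] i; have /andP[ax xb] := xB i.
  have key c : a i <= c <= b i -> w i * c <= w i * x ord0 i.
    move=> cab.
    pose y : 'rV[R]_m := \row_j (if j == i then c else x ord0 j).
    have yB : box a b y by move=> j; rewrite mxE; case: eqP => [->//|_]; apply: xB.
    have := xmax _ yB; rewrite /dotp (bigD1 i)//= [leRHS](bigD1 i)//= !mxE eqxx.
    rewrite [X in _ + X <= _](_ : _ = \sum_(j < m | j != i) x ord0 j * w j).
      by rewrite lerD2r ![_ * w i]mulrC.
    by apply: eq_bigr => j /negPf ji; rewrite mxE ji.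
  have [w0|w0|_] := ltgtP (w i) 0; rewrite ?ax ?xb//= ?andbT.
  + by have := key (a i); rewrite lexx ab => /(_ isT); rewrite ler_nM2l.
  + by have := key (b i); rewrite lexx ab => /(_ isT); rewrite ler_pM2l.
- move=> xF.
  have xB : box a b x.
    move=> i; have := xF i; have := ab i; case: (ltgtP (w i) 0) => //= _ abi /andP[h1 h2].
      by rewrite h1 (le_trans h2).
    by rewrite h2 (le_trans abi).
  split=> // y yB; apply: ler_sum => i _; have := xF i; have /andP[ay yb] := yB i.
  have [w0|w0|->] := ltgtP (w i) 0; rewrite ?mulr0// => /andP[h1 h2].
  + by rewrite ler_nM2r// (le_trans h2).
  + by rewrite ler_pM2r// (le_trans yb).
Qed.

Lemma is_face_box (R : realType) (m : nat) (a b : 'I_m -> R)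
    (F : set 'rV[R]_m) : (forall i, a i <= b i) ->
  is_face (box a b) F <->
  exists a' b', F = box a' b' /\ forall i, side (a i) (b i) (a' i) (b' i).
Proof.
move=> ab; split.
- move=> [_ [l ->]].
  have [w lE] : exists w, forall x, l x = dotp w x.
    by exists (fun i => l (delta_mx ord0 i)) => x; apply: scalarE.
  exists (fun i => if 0 < w i then b i else a i),
    (fun i => if w i < 0 then a i else b i); split.
    apply: etrans (box_argmax w ab); apply/seteqP; split=> x /= [xB xmax];
      by split=> // y yB; have := xmax y yB; rewrite !lE.
  by move=> i; case: ltgtP => _; constructor.
- move=> [a' [b' [-> sd]]]; split.
    exists (\row_i a' i) => i; rewrite mxE lexx /=.
    by have := ab i; case: (sd i).
  (* Weight 0 keeps the whole side, -1 selects its lower end and 1 its upper end. On a degenerate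
     side the three choices coincide and the weight is 0. *)
  pose w i : R :=
    if a' i == a i then if b' i == b i then 0 else -1 else 1.
  exists (dotp w); rewrite box_argmax//.
  apply/seteqP; split=> x /= xF i; have := xF i; rewrite /w;
    case: (sd i); rewrite ?eqxx ?ltxx//=.
  + by case: eqP => [->|]; rewrite ?ltxx// ltrN10 ltr0N1.
  + by case: eqP => [->|]; rewrite ?ltxx// ltr01 ltr10.
  + by case: eqP => [->|]; rewrite ?ltxx// ltrN10 ltr0N1.
  + by case: eqP => [->|]; rewrite ?ltxx// ltr01 ltr10.
Qed.

Lemma side_trans (R : realType) (a b a1 b1 a2 b2 : R) :
  side a b a1 b1 -> side a1 b1 a2 b2 -> side a b a2 b2.
Proof. by case; case; constructor. Qed.

Lemma side_le (R : realType) (a b a' b' : R) :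
  a <= b -> side a b a' b' -> [/\ a <= a', a' <= b' & b' <= b].
Proof. by move=> ab; case. Qed.

Lemma grid_side_le (R : realType) (a b : R) : grid_side a b -> a <= b.
Proof. by case; lra. Qed.

Lemma grid_side_face (R : realType) (a b a' b' : R) :
  grid_side a b -> side a b a' b' -> grid_side a' b'.
Proof. by case; case; constructor. Qed.

(** Two distinct grid intervals that meet do so in an end point. This is the one-dimensional case of
    the intersection axiom of cubical complexes. *)
Lemma grid_sideI (R : realType) (a b a' b' : R) :
  grid_side a b -> grid_side a' b' -> Num.max a a' <= Num.min b b' ->
  side a b (Num.max a a') (Num.min b b').
Proof.
case; case; rewrite /Num.max /Num.min; do 2 case: ltP => ?; try lra;
  by try constructor.
Qed.

Lemma grid_cellE (R : realType) (m : nat) (Q : set 'rV[R]_m) :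
  grid_cell Q <->
  exists a b, Q = box a b /\ forall i, grid_side (a i) (b i).
Proof.
have cubeE (A : {set 'I_m}) : unit_cube R A =
    box (fun i => if i \in A then 0 else -1) (fun i => if i \in A then 1 else 0).
  by apply/seteqP; split=> x /= xA i; have := xA i; case: (i \in A).
have le_cube (A : {set 'I_m}) i :
    (if i \in A then 0 else -1) <= (if i \in A then 1 else 0) :> R.
  by case: ifP => _; lra.
split=> [[A]|[a [b [-> ab]]]].
- rewrite cubeE => /(is_face_box _ (le_cube A)) [a [b [-> sd]]].
  by exists a, b; split=> // i; have := sd i; case: ifP => _; case; constructor.
(* A cell may lie in several unit cubes. A side reduced to 0 is assigned to [0,1], as its lower
   end. *)
- exists [set i | 0 <= a i]%SET; rewrite cubeE; apply/(is_face_box _ (le_cube _)).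
  exists a, b; split=> // i; rewrite inE; case: (ab i);
    rewrite ?lexx ?ler01 ?ler0N1 ?oppr_ge0 ?ler10; by constructor.
Qed.

Lemma is_cube_box (R : realType) (m : nat) (a b : 'I_m -> R) :
  (forall i, grid_side (a i) (b i)) -> is_cube (box a b).
Proof.
(* The edges are the unit vectors of the nondegenerate sides, all of which have length 1, and the
   base point is the lower corner. *)
move=> ab; pose S := [set i | a i < b i]%SET.
pose w : 'M[R]_(#|S|, m) := \matrix_(k, j) (enum_val k == j)%:R.
have wE (t : 'rV[R]_#|S|) j : (forall k, enum_val k = j -> (t *m w) ord0 j = t ord0 k)
    /\ (j \notin S -> (t *m w) ord0 j = 0).
  split=> [k kj|jS]; rewrite mxE.
    rewrite (bigD1 k)//= mxE kj eqxx mulr1 big1 ?addr0// => k' k'k.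
    by rewrite mxE -kj (inj_eq enum_val_inj) (negPf k'k) mulr0.
  rewrite big1// => k _; rewrite mxE; case: eqP => [kj|]; last by rewrite mulr0.
  by move: jS; rewrite -kj enum_valP.
exists #|S|, (\row_i a i), w; split.
  apply/row_freeP; exists w^T; apply/matrixP => k k'; rewrite !mxE.
  rewrite (bigD1 (enum_val k))//= !mxE eqxx mul1r big1 ?addr0.
    by rewrite (inj_eq enum_val_inj) eq_sym.
  by move=> j jk; rewrite mxE eq_sym (negPf jk) mul0r.
apply/seteqP; split=> x /=.
- move=> xB; exists (\row_k (x ord0 (enum_val k) - a (enum_val k))).
    move=> k; rewrite mxE; have := xB (enum_val k); have := enum_valP k.
    by rewrite inE; case: (ab (enum_val k)); lra.
  apply/rowP => j; rewrite mxE [X in X + _]mxE; have [jS|jS] := boolP (j \in S).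
    rewrite ((wE _ j).1 (enum_rank_in jS j)); last exact: enum_rankK_in.
    by rewrite mxE enum_rankK_in// addrC subrK.
  rewrite (wE _ j).2// addr0; have := xB j; move: jS; rewrite inE.
  by case: (ab j); lra.
- move=> [t t01 <-] j; rewrite mxE [X in X + _]mxE.
  have [jS|jS] := boolP (j \in S).
    rewrite ((wE _ j).1 (enum_rank_in jS j)); last exact: enum_rankK_in.
    have := t01 (enum_rank_in jS j); have : a j < b j by move: jS; rewrite inE.
    by move: (t _ _) => u; case: (ab j); lra.
  rewrite (wE _ j).2// addr0; move: jS; rewrite inE.
  by case: (ab j); lra.
Qed.

Lemma finite_grid_cells (R : realType) (m : nat) :
  finite_set [set Q : set 'rV[R]_m | grid_cell Q].
Proof.
(* The end points -1, 0, 1 are coded as k - 1 with k < 3. Only the fact that all grid cells are in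
   the range matters. *)
pose f (c : {ffun 'I_m -> 'I_3 * 'I_3}) : set 'rV[R]_m :=
  box (fun i => (c i).1%:R - 1) (fun i => (c i).2%:R - 1).
apply: (@sub_finite_set _ _ (range f)); last exact/finite_image/finite_finset.
move=> Q /= /grid_cellE [a [b [-> ab]]].
have code i : exists p : 'I_3 * 'I_3, a i = p.1%:R - 1 /\ b i = p.2%:R - 1.
  case: (ab i).
  - by exists (inord 0, inord 0); rewrite /= !inordK//; split; lra.
  - by exists (inord 0, inord 1); rewrite /= !inordK//; split; lra.
  - by exists (inord 1, inord 1); rewrite /= !inordK//; split; lra.
  - by exists (inord 1, inord 2); rewrite /= !inordK//; split; lra.
  - by exists (inord 2, inord 2); rewrite /= !inordK//; split; lra.
have [g gE] := choice code; exists (finfun g) => //; rewrite /f.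
by congr box; apply/funext => i; rewrite ffunE; have [] := gE i.
Qed.

(** [X] can be arbitrary: containment in [X] passes to faces, and the other axioms concern the grid
    alone. *)
Lemma cubical_grid_subcomplex (R : realType) (m : nat) (X : set 'rV[R]_m) :
  cubical_complex (grid_subcomplex X).
Proof.
split.
- by apply: sub_finite_set (@finite_grid_cells R m) => Q [].
- by move=> Q [/grid_cellE [a [b [-> ab]]] _]; apply: is_cube_box.
- move=> Q F [/grid_cellE [a [b [-> ab]]] QX].
  have leab i := grid_side_le (ab i).
  move=> /(is_face_box _ leab) [a' [b' [-> sd]]]; split.
    by apply/grid_cellE; exists a', b'; split=> // i; apply: grid_side_face (sd i).
  move=> x xF; apply: QX => i; have [? _ ?] := side_le (leab i) (sd i).
  by have /andP[h1 h2] := xF i; rewrite (le_trans _ h1)// (le_trans h2).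
- move=> _ _ [/grid_cellE [a [b [-> ab]]] _] [/grid_cellE [c [d [-> cd]]] _].
  have leab i := grid_side_le (ab i); have lecd i := grid_side_le (cd i).
  have PQ : box a b `&` box c d =
      box (fun i => Num.max (a i) (c i)) (fun i => Num.min (b i) (d i)).
    apply/seteqP; split=> x /=.
      by move=> [xa xc] i; rewrite ge_max le_min andbACA xa xc.
    by move=> xac; split=> i; have := xac i; rewrite ge_max le_min andbACA => /andP[].
  rewrite PQ; set I := (X in X = set0).
  have [->|/set0P[x xI]] := eqVneq I set0; [by left|right].
  have le_I i := andP (xI i).
  split; apply/is_face_box; [exact: leab| |exact: lecd|].
    exists (fun i => Num.max (a i) (c i)), (fun i => Num.min (b i) (d i)).
    split=> // i; apply: grid_sideI (ab i) (cd i) _.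
    by have [h1 h2] := le_I i; exact: le_trans h1 h2.
  exists (fun i => Num.max (c i) (a i)), (fun i => Num.min (d i) (b i)); split.
    by congr box; apply/funext => i; rewrite (maxC, minC).
  move=> i; apply: grid_sideI (cd i) (ab i) _; rewrite maxC minC.
  by have [h1 h2] := le_I i; exact: le_trans h1 h2.
Qed.

(** * Signs of coordinates and the cubes of the Bier sphere *)

Definition supp (R : realType) (m : nat) (x : 'rV[R]_m) : {set 'I_m + 'I_m} :=
  [set s | match s with
           | inl i => 0 < x ord0 i
           | inr i => x ord0 i < 0
           end]%SET.

(** The condition that I and J are disjoint, stated on the simplex. It keeps the sides of C_tau from
    being [-1,1], and it lets at most one vertex contribute to each coordinate, so that the
    coefficients of a convex combination are absolute values of coordinates. *)
Definition antipode_free (m : nat) (tau : {set 'I_m + 'I_m}) : Prop :=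
  forall i, ~~ ((inl i \in tau) && (inr i \in tau)).

Lemma antipode_free_supp (R : realType) (m : nat) (x : 'rV[R]_m) :
  antipode_free (supp x).
Proof. by move=> i; rewrite !inE; case: ltgtP. Qed.

Lemma antipode_free_sub (m : nat) (tau sigma : {set 'I_m + 'I_m}) :
  antipode_free tau -> sigma \subset tau -> antipode_free sigma.
Proof.
move=> hp /fintype.subsetP st i; apply: contra (hp i) => /andP[h1 h2].
by rewrite !st.
Qed.

Lemma supp_subP (R : realType) (m : nat) (x : 'rV[R]_m)
    (tau : {set 'I_m + 'I_m}) :
  supp x \subset tau <->
  forall i, (0 < x ord0 i -> inl i \in tau) /\ (x ord0 i < 0 -> inr i \in tau).
Proof.
split=> [/fintype.subsetP st i|h].
  by split=> xi; apply: st; rewrite inE.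
by apply/fintype.subsetP => -[i|i]; rewrite inE; have [] := h i.
Qed.

Lemma BierP (m : nat) (K : {set {set 'I_m}}) (tau : {set 'I_m + 'I_m}) :
  tau \in Bier K <->
  [/\ [set i | inl i \in tau]%SET \in K,
      [set i | inr i \in tau]%SET \in alexander_dual K & antipode_free tau].
Proof.
have linj : injective (@inl 'I_m 'I_m) by move=> ? ? [].
have rinj : injective (@inr 'I_m 'I_m) by move=> ? ? [].
have inlE (I J : {set 'I_m}) i : (inl i \in (inl @: I :|: inr @: J)%SET) = (i \in I).
  rewrite inE mem_imset//; case: (i \in I) => //=.
  by apply/negbTE/negP => /imsetP[? _].
have inrE (I J : {set 'I_m}) i : (inr i \in (inl @: I :|: inr @: J)%SET) = (i \in J).
  rewrite inE mem_imset//; case: (i \in J); rewrite ?orbT ?orbF//.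
  by apply/negbTE/negP => /imsetP[? _].
split=> [/imset2P[I J IK]|[tK tD hp]].
- rewrite inE => /andP[JK IJ] ->; split.
  + by rewrite (_ : finset _ = I)//; apply/setP => i; rewrite inE inlE.
  + by rewrite (_ : finset _ = J)//; apply/setP => i; rewrite inE inrE.
  + move=> i; rewrite inlE inrE; apply/negP => /andP[iI iJ].
    by move: IJ; rewrite disjoint_subset => /fintype.subsetP/(_ i iI); rewrite inE iJ.
- apply/imset2P; exists [set i | inl i \in tau]%SET [set i | inr i \in tau]%SET => //.
    rewrite inE tD disjoint_subset; apply/fintype.subsetP => i; rewrite !inE => il.
    by have := hp i; rewrite il.
  by apply/setP => -[i|i]; rewrite ?inlE ?inrE inE.
Qed.

Lemma alexander_dual_sub (m : nat) (K : {set {set 'I_m}}) (I J : {set 'I_m}) :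
  simplicial_complex K -> I \in alexander_dual K -> J \subset I ->
  J \in alexander_dual K.
Proof.
move=> [_ hK]; rewrite !inE => IK JI; apply: contra IK => JK.
by apply: hK JK _; rewrite finset.setCS.
Qed.

Lemma Bier_sub (m : nat) (K : {set {set 'I_m}}) (tau sigma : {set 'I_m + 'I_m}) :
  simplicial_complex K -> tau \in Bier K -> sigma \subset tau ->
  sigma \in Bier K.
Proof.
move=> hK /BierP[tK tD hp] st; have /fintype.subsetP stP := st; apply/BierP; split.
- apply: hK.2 tK _; apply/fintype.subsetP => i; rewrite !inE; exact: stP.
- apply: alexander_dual_sub hK tD _; apply/fintype.subsetP => i; rewrite !inE; exact: stP.
- exact: antipode_free_sub hp st.
Qed.

Lemma sum_simplex (R : realType) (m : nat) (tau : {set 'I_m + 'I_m})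
    (F : 'I_m + 'I_m -> R) :
  \sum_(s in tau) F s =
  \sum_i ((if inl i \in tau then F (inl i) else 0) +
          (if inr i \in tau then F (inr i) else 0)).
Proof. by rewrite big_sumType/= big_split/= -!big_mkcond. Qed.

Lemma comb_vtxE (R : realType) (m : nat) (tau : {set 'I_m + 'I_m})
    (c : 'I_m + 'I_m -> R) i :
  (\sum_(s in tau) c s *: vtx R s) ord0 i =
  (if inl i \in tau then c (inl i) else 0) -
  (if inr i \in tau then c (inr i) else 0).
Proof.
rewrite summxE sum_simplex (bigD1 i)//= big1 ?addr0 => [|j ji].
  by rewrite !mxE !eqxx mulr1 mulrN1; case: (inr i \in tau); rewrite ?oppr0.
rewrite !mxE eqxx/= [i == j]eq_sym (negPf ji) !mulr0n oppr0 !mulr0.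
by do 2 case: ifP => _; rewrite ?addr0.
Qed.

Definition cube_lo (R : realType) (m : nat) (tau : {set 'I_m + 'I_m}) (i : 'I_m) : R :=
  if inr i \in tau then -1 else 0.
Definition cube_hi (R : realType) (m : nat) (tau : {set 'I_m + 'I_m}) (i : 'I_m) : R :=
  if inl i \in tau then 1 else 0.
Arguments cube_lo R {m} tau i.
Arguments cube_hi R {m} tau i.

Lemma cube_lo_le_hi (R : realType) (m : nat) (tau : {set 'I_m + 'I_m}) i :
  cube_lo R tau i <= cube_hi R tau i.
Proof. by rewrite /cube_lo /cube_hi; do 2 case: ifP => _; lra. Qed.

Lemma grid_side_cube (R : realType) (m : nat) (tau : {set 'I_m + 'I_m}) i :
  antipode_free tau -> grid_side (cube_lo R tau i) (cube_hi R tau i).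
Proof.
by move=> /(_ i); rewrite /cube_lo /cube_hi; do 2 case: ifP => _ //=; constructor.
Qed.

Lemma cube_of_box (R : realType) (m : nat) (tau : {set 'I_m + 'I_m}) :
  antipode_free tau -> cube_of R tau = box (cube_lo R tau) (cube_hi R tau).
Proof.
move=> hp; apply/seteqP; split=> x /=.
- move=> [y yP <-] i.
  have /choice[t tP] : forall s, exists t : R,
      s \in tau -> 0 <= t <= 1 /\ t *: vtx R s = y s.
    move=> s; case: (boolP (s \in tau)) => [/yP[t]|]; last by exists 0.
    by rewrite /= in_itv /= => t01 tE; exists t.
  rewrite (eq_bigr (fun s => t s *: vtx R s)) => [|s /tP[]//].
  rewrite comb_vtxE /cube_lo /cube_hi; have := hp i.
  by case: ifP => [/tP[+ _]|_]; case: ifP => [/tP[+ _]|_] //=; lra.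
- move=> xB.
  pose t (s : 'I_m + 'I_m) : R :=
    match s with inl i => x ord0 i | inr i => - x ord0 i end.
  exists (fun s => t s *: vtx R s).
    move=> s sT; exists (t s) => //=; rewrite in_itv /=; move: sT.
    by case: s => i /= iT; have := xB i; have := hp i;
      rewrite /cube_lo /cube_hi iT; case: ifP => //= _ _; lra.
  apply/rowP => i; rewrite comb_vtxE /t; move: (hp i) (xB i); rewrite /cube_lo /cube_hi.
  by case: ifP => _; case: ifP => _ //=; lra.
Qed.

Lemma cube_ofE (R : realType) (m : nat) (tau : {set 'I_m + 'I_m}) :
  antipode_free tau ->
  cube_of R tau = [set x | supp x \subset tau /\ forall i, `|x ord0 i| <= 1].
Proof.
move=> hp; rewrite cube_of_box//; apply/seteqP; split=> x /=.
- move=> xB; split.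
    apply/supp_subP => i; have := xB i; rewrite /cube_lo /cube_hi.
    by case: ifP => _; case: ifP => _; split=> //; lra.
  move=> i; have := xB i; rewrite /cube_lo /cube_hi ler_norml.
  by case: ifP => _; case: ifP => _; lra.
- move=> [/supp_subP xt x1] i; have := x1 i; rewrite ler_norml /cube_lo /cube_hi.
  have [xp xn] := xt i.
  by case: (ltgtP (x ord0 i) 0) xp xn => [? _ /(_ isT)->|? /(_ isT)-> _|-> _ _];
    repeat case: ifP => _; lra.
Qed.

Lemma hull_vtxE (R : realType) (m : nat) (tau : {set 'I_m + 'I_m}) :
  antipode_free tau ->
  hull tau (@vtx R m) = [set x | supp x \subset tau /\ \sum_i `|x ord0 i| = 1].
Proof.
move=> hp; apply/seteqP; split=> x /=.
- move=> [c [c0 c1] <-]; split.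
    apply/supp_subP => i; rewrite comb_vtxE.
    case: ifP => il; case: ifP => ir; split=> //; rewrite ?subrr ?ltxx//.
      by rewrite subr0 ltNge c0.
    by rewrite sub0r oppr_gt0 ltNge c0.
  rewrite -c1 sum_simplex; apply: eq_bigr => i _; rewrite comb_vtxE.
  have := hp i; case: ifP => [/c0 il|_]; case: ifP => [/c0 ir|_] //= _.
  + by rewrite subr0 addr0 ger0_norm.
  + by rewrite sub0r add0r normrN ger0_norm.
  + by rewrite subr0 addr0 normr0.
- move=> [/supp_subP xt x1].
  pose c (s : 'I_m + 'I_m) : R := match s with inl i | inr i => `|x ord0 i| end.
  exists c.
    split=> [[i|i] _ //=|].
    rewrite -x1 sum_simplex; apply: eq_bigr => i _ /=; have [xp xn] := xt i.
    by case: (ltgtP (x ord0 i) 0) xp xn (hp i) => [_ _ /(_ isT)->|_ /(_ isT)-> _|-> _ _];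
      case: ifP => //= *; rewrite ?normr0 ?if_same ?addr0 ?add0r.
  apply/rowP => i; rewrite comb_vtxE /c; have [xp xn] := xt i.
  case: (ltgtP (x ord0 i) 0) xp xn (hp i) => [x0 _ /(_ isT)->|x0 /(_ isT)-> _|-> _ _].
  + by case: ifP => //= *; rewrite ltr0_norm// sub0r opprK.
  + by case: ifP => //= *; rewrite gtr0_norm// subr0.
  + by rewrite normr0 !if_same subr0.
Qed.

(** Any witness for the first product contains all i with x_i > 0, and that set is itself a witness
    as K is closed under subsets. The negative coordinates play the same role for the dual. *)
Lemma ZsetE (R : realType) (m : nat) (K : {set {set 'I_m}}) :
  simplicial_complex K ->
  Zset R K = [set x | supp x \in Bier K /\ forall i, `|x ord0 i| <= 1].
Proof.
move=> hK; apply/seteqP; split=> x /=.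
- move=> [[I /= IK xI] [J /= JK xJ]].
  split; last first.
    by move=> i; rewrite ler_norml; have := xI i; case: ifP => _ /=;
      rewrite in_itv /=; lra.
  apply/BierP; split; last exact: antipode_free_supp.
  + apply: hK.2 IK _; apply/fintype.subsetP => i; rewrite !inE => xi.
    by have := xI i; case: ifP => //= _; rewrite in_itv /=; lra.
  + apply: alexander_dual_sub hK JK _; apply/fintype.subsetP => i; rewrite !inE => xi.
    by have := xJ i; case: ifP => //= _; rewrite in_itv /=; lra.
- move=> [/BierP[xK xD _] x1]; split.
    exists [set i | inl i \in supp x]%SET => //= i; have := x1 i.
    by rewrite ler_norml !inE; case: ltP => xi; rewrite /= in_itv /=; lra.
  exists [set i | inr i \in supp x]%SET => //= i; have := x1 i.
  by rewrite ler_norml !inE; case: ltP => xi; rewrite /= in_itv /=; lra.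
Qed.

Lemma realizationE (R : realType) (m : nat) (K : {set {set 'I_m}}) :
  simplicial_complex K ->
  realization R (Bier K) =
  [set x | supp x \in Bier K /\ \sum_i `|x ord0 i| = 1].
Proof.
move=> hK; apply/seteqP; split=> x /=.
- move=> [tau /= tB]; rewrite hull_vtxE; last by have /BierP[] := tB.
  by move=> [st ?]; split=> //; apply: Bier_sub hK tB st.
- by move=> [xB x1]; exists (supp x) => //; rewrite hull_vtxE//;
    apply: antipode_free_supp.
Qed.

Lemma Zset_cubes (R : realType) (m : nat) (K : {set {set 'I_m}}) :
  simplicial_complex K ->
  Zset R K = \bigcup_(tau in [set tau | tau \in Bier K]) cube_of R tau.
Proof.
move=> hK; rewrite ZsetE//; apply/seteqP; split=> x /=.
- by move=> [xB x1]; exists (supp x) => //; rewrite cube_ofE//;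
    apply: antipode_free_supp.
- move=> [tau /= tB]; rewrite cube_ofE; last by have /BierP[] := tB.
  by move=> [st ?]; split=> //; apply: Bier_sub hK tB st.
Qed.

Lemma is_face_cubeP (R : realType) (m : nat) (tau : {set 'I_m + 'I_m})
    (Q : set 'rV[R]_m) : antipode_free tau ->
  is_face (cube_of R tau) Q <->
  exists a b, Q = box a b /\
    forall i, side (cube_lo R tau i) (cube_hi R tau i) (a i) (b i).
Proof.
by move=> hp; rewrite cube_of_box//; apply: is_face_box => i; apply: cube_lo_le_hi.
Qed.

Lemma face_cube_grid (R : realType) (m : nat) (tau : {set 'I_m + 'I_m})
    (Q : set 'rV[R]_m) : antipode_free tau ->
  is_face (cube_of R tau) Q -> grid_cell Q.
Proof.
move=> hp /(is_face_cubeP _ hp)[a [b [-> sd]]]; apply/grid_cellE.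
by exists a, b; split=> // i; apply: grid_side_face (grid_side_cube R i hp) (sd i).
Qed.

Lemma box_midpoint (R : realType) (m : nat) (a b : 'I_m -> R) :
  (forall i, a i <= b i) -> box a b (\row_i ((a i + b i) / 2)).
Proof. by move=> ab i; rewrite mxE; have := ab i; lra. Qed.

(* The simplex is read off the signs of the midpoint of the cell. *)
Lemma grid_subcomplex_Zset (R : realType) (m : nat) (K : {set {set 'I_m}}) :
  simplicial_complex K ->
  grid_subcomplex (Zset R K) =
  [set Q | exists2 tau, tau \in Bier K & is_face (cube_of R tau) Q].
Proof.
move=> hK; apply/seteqP; split=> Q /=.
- move=> [/grid_cellE[a [b [-> ab]]] QZ].
  have leab i := grid_side_le (ab i).
  have := QZ _ (box_midpoint leab); rewrite ZsetE//= => -[midB _].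
  exists (supp (\row_i ((a i + b i) / 2))) => //.
  apply/is_face_cubeP; first exact: antipode_free_supp.
  exists a, b; split=> // i; rewrite /cube_lo /cube_hi !inE mxE.
  by case: (ab i); case: ltP => ?; case: ltP => ?; try lra; constructor.
- move=> [tau tB Qt]; have /BierP[_ _ hp] := tB; split; first exact: face_cube_grid Qt.
  by rewrite Zset_cubes// => x Qx; exists tau => //; case: Qt => _ [l lE];
    move: Qx; rewrite lE => -[].
Qed.

(** * Facets of a cube through its apex *)

Definition cube_facet (R : realType) (m : nat) (tau : {set 'I_m + 'I_m})
    (i : 'I_m) : set 'rV[R]_m :=
  cube_of R tau `&` [set x | `|x ord0 i| = 1].
Arguments cube_facet R {m} tau i.

(** A supported side has 0 as one of its ends, so the sum of the two ends is the other one, which is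
    the only point of absolute value 1 on that side. *)
Lemma cube_facet_box (R : realType) (m : nat) (tau : {set 'I_m + 'I_m}) i :
  antipode_free tau -> (inl i \in tau) || (inr i \in tau) ->
  cube_facet R tau i =
  box (fun j => if j == i then cube_lo R tau i + cube_hi R tau i else cube_lo R tau j)
      (fun j => if j == i then cube_lo R tau i + cube_hi R tau i else cube_hi R tau j).
Proof.
move=> hp it; rewrite /cube_facet cube_of_box//; apply/seteqP; split=> x /=.
- move=> [xB xi] j; have := xB j; have [-> _|//] := eqVneq j i; move: (xB i) xi (hp i) it.
  rewrite /cube_lo /cube_hi; case: ifP => _; case: ifP => _ //= ? xi _ _;
    by case: (lerP 0 (x ord0 i)) xi => [/ger0_norm->|/ltr0_norm->]; lra.
- move=> xB.
  have xi : x ord0 i = cube_lo R tau i + cube_hi R tau i.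
    by have := xB i; rewrite eqxx -eq_le => /eqP.
  split.
    move=> j; have := xB j; have [-> _|//] := eqVneq j i; rewrite xi /cube_lo /cube_hi.
    by do 2 case: ifP => _; lra.
  move: (hp i) it; rewrite xi /cube_lo /cube_hi.
  by case: ifP => _; case: ifP => _ //=; rewrite ?addr0 ?add0r ?normrN normr1.
Qed.

Lemma apexE (R : realType) (m : nat) (tau : {set 'I_m + 'I_m}) i :
  apex R tau ord0 i = cube_lo R tau i + cube_hi R tau i.
Proof.
have -> : apex R tau = \sum_(s in tau) 1 *: vtx R s.
  by apply: eq_bigr => s _; rewrite scale1r.
by rewrite comb_vtxE /cube_lo /cube_hi; do 2 case: ifP => _; lra.
Qed.

Lemma cube_facet_face (R : realType) (m : nat) (tau : {set 'I_m + 'I_m}) i :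
  antipode_free tau -> (inl i \in tau) || (inr i \in tau) ->
  is_face (cube_of R tau) (cube_facet R tau i).
Proof.
move=> hp it; rewrite cube_facet_box//; apply/(is_face_cubeP _ hp).
do 2 eexists; split; first reflexivity.
move=> j; have [->|_] := eqVneq j i; last by constructor.
rewrite /cube_lo /cube_hi; move: (hp i) it.
by case: ifP => _; case: ifP => _ //=; rewrite ?addr0 ?add0r; constructor.
Qed.

Lemma box_lo (R : realType) (m : nat) (a b : 'I_m -> R) :
  (forall i, a i <= b i) -> box a b (\row_i a i).
Proof. by move=> ab i; rewrite mxE lexx ab. Qed.

Lemma box_hi (R : realType) (m : nat) (a b : 'I_m -> R) :
  (forall i, a i <= b i) -> box a b (\row_i b i).
Proof. by move=> ab i; rewrite mxE lexx ab. Qed.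

Lemma cube_norm1_supported (R : realType) (m : nat) (tau : {set 'I_m + 'I_m})
    (x : 'rV[R]_m) i : antipode_free tau -> cube_of R tau x ->
  `|x ord0 i| = 1 -> (inl i \in tau) || (inr i \in tau).
Proof.
move=> hp; rewrite cube_ofE//= => -[/supp_subP/(_ i)[xp xn] _] xi.
have [/xn->|/xp->//|x0] := ltgtP (x ord0 i) 0; first by rewrite orbT.
by move: xi; rewrite x0 normr0 => /esym/eqP; rewrite oner_eq0.
Qed.

(** A proper face through the apex is fixed at the far end of some supported side, hence lies in the
    corresponding [cube_facet], and maximality makes them equal. Conversely, a face containing
    [cube_facet R tau i] is full in all coordinates other than [i], which leaves only the facet and
    the whole cube. *)
Lemma facet_apexP (R : realType) (m : nat) (tau : {set 'I_m + 'I_m})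
    (F : set 'rV[R]_m) : antipode_free tau ->
  (is_facet (cube_of R tau) F /\ F (apex R tau)) <->
  exists2 i, (inl i \in tau) || (inr i \in tau) & F = cube_facet R tau i.
Proof.
move=> hp; pose lo := cube_lo R tau; pose hi := cube_hi R tau.
have le_lohi i : lo i <= hi i := cube_lo_le_hi R tau i.
have apex_in : cube_of R tau (apex R tau).
  rewrite cube_of_box// => i; rewrite apexE /cube_lo /cube_hi.
  by do 2 case: ifP => _; lra.
have unsupported i : ~~ ((inl i \in tau) || (inr i \in tau)) -> lo i = 0 /\ hi i = 0.
  by rewrite negb_or /lo /hi /cube_lo /cube_hi => /andP[/negPf-> /negPf->].
have facet_neq i : (inl i \in tau) || (inr i \in tau) ->
    cube_facet R tau i <> cube_of R tau.
  (* The facet is proper because it misses the origin. *)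
  move=> it E; have : cube_of R tau 0.
    rewrite cube_of_box// => j; rewrite mxE /cube_lo /cube_hi.
    by do 2 case: ifP => _; lra.
  by rewrite -E => -[_] /=; rewrite mxE normr0 => /esym/eqP; rewrite oner_eq0.
have apex_facet i : (inl i \in tau) || (inr i \in tau) ->
    cube_facet R tau i (apex R tau).
  move=> it; split=> //=; rewrite apexE /cube_lo /cube_hi; move: (hp i) it.
  by case: ifP => _; case: ifP => _ //=; rewrite ?addr0 ?add0r ?normrN normr1.
split.
- move=> [[Fface Fneq Fmax] Fapex].
  have /(is_face_cubeP _ hp)[a [b [FE sd]]] := Fface.
  have [i it Fi] : exists2 i, (inl i \in tau) || (inr i \in tau) &
      F `<=` cube_facet R tau i.
    apply: contrapT => Nex; apply: Fneq; rewrite FE cube_of_box//.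
    suff E i : a i = lo i /\ b i = hi i.
      by congr box; apply/funext => i; have [] := E i.
    have [/unsupported[l0 h0]|/negPn it] := boolP (~~ ((inl i \in tau) || (inr i \in tau))).
      by have := sd i; rewrite -/(lo i) -/(hi i) l0 h0; case.
    apply: contrapT => NE; apply: Nex; exists i => // x Fx; split.
      by case: Fface Fx => _ [l ->] [].
    rewrite /=; move: Fapex Fx NE; rewrite FE => /(_ i) + /(_ i); rewrite apexE.
    move: it (sd i) (hp i); rewrite /lo /hi /cube_lo /cube_hi.
    case: ifP => _; case: ifP => _ //= _; case=> // _ /=; rewrite ?addr0 ?add0r => ? /andP[? ?] NE;
      try (by exfalso; apply: NE); try lra.
    + by rewrite (_ : x ord0 i = -1) ?normrN1//; lra.
    + by rewrite (_ : x ord0 i = 1) ?normr1//; lra.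
  exists i => //; have [//|E] := Fmax _ (cube_facet_face R hp it) Fi.
  by have := facet_neq i it.
- move=> [i it ->]; split; last exact: apex_facet.
  split; [exact: cube_facet_face|exact: facet_neq|].
  move=> G /(is_face_cubeP _ hp)[a [b [-> sd]]] FG.
  have FlE := cube_facet_box R hp it.
  set lo' := (fun j : 'I_m => _) in FlE; set hi' := (X in box lo' X) in FlE.
  have le' j : lo' j <= hi' j by rewrite /lo' /hi'; have [|] := eqVneq j i.
  move: FG; rewrite FlE => FG.
  (* Evaluating the inclusion at the two extreme corners of the facet bounds the sides of [G]. *)
  have Glo j : a j <= lo' j.
    by have := FG _ (box_lo le') j; rewrite mxE => /andP[].
  have Ghi j : hi' j <= b j.
    by have := FG _ (box_hi le') j; rewrite mxE => /andP[].
  have out j : j != i -> a j = lo j /\ b j = hi j.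
    move=> /negPf ji; have := Glo j; have := Ghi j; rewrite /lo' /hi' ji -/(lo j) -/(hi j).
    by have := le_lohi j; case: (sd j) => *; split=> //; lra.
  have [[ai bi]|abi] := pselect (a i = lo i /\ b i = hi i).
    right; rewrite cube_of_box//; congr box; apply/funext => j;
      by have [->|/out[]] := eqVneq j i.
  left; suff [ai bi] : a i = lo i + hi i /\ b i = lo i + hi i.
    by congr box; apply/funext => j; rewrite /lo' /hi';
      have [->|/out[]] := eqVneq j i.
  have := Glo i; have := Ghi i; rewrite /lo' /hi' eqxx; move: abi (hp i) it (sd i).
  rewrite /lo /hi /cube_lo /cube_hi; move: (a i) (b i) => u v.
  by case: ifP => _; case: ifP => _ //= abi _ _ uv; case: uv abi => abi *;
    solve [case: abi|split; lra].
Qed.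

(** * Fronts *)

Lemma is_face_sub (R : realType) (m : nat) (P F : set 'rV[R]_m) :
  is_face P F -> F `<=` P.
Proof. by move=> [_ [l ->]] x []. Qed.

Lemma is_face_box_refl (R : realType) (m : nat) (a b : 'I_m -> R) :
  (forall i, a i <= b i) -> is_face (box a b) (box a b).
Proof. by move=> ab; apply/is_face_box => //; exists a, b; split=> // i; constructor. Qed.

Lemma is_face_box_trans (R : realType) (m : nat) (a b : 'I_m -> R)
    (F G : set 'rV[R]_m) : (forall i, a i <= b i) ->
  is_face (box a b) F -> is_face F G -> is_face (box a b) G.
Proof.
move=> ab /(is_face_box _ ab)[a1 [b1 [-> sd1]]].
have ab1 i : a1 i <= b1 i by have [] := side_le (ab i) (sd1 i).
move=> /(is_face_box _ ab1)[a2 [b2 [-> sd2]]]; apply/is_face_box => //.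
by exists a2, b2; split=> // i; apply: side_trans (sd1 i) (sd2 i).
Qed.

Lemma FrontE (R : realType) (m : nat) (tau : {set 'I_m + 'I_m}) :
  antipode_free tau ->
  Front R tau = [set x | cube_of R tau x /\ exists i, `|x ord0 i| = 1].
Proof.
move=> hp; apply/seteqP; split=> x /=.
- by move=> [F /= /(facet_apexP _ hp)[i it ->] [xt xi]]; split=> //; exists i.
- move=> [xt [i xi]]; have it := cube_norm1_supported hp xt xi.
  by exists (cube_facet R tau i) => //=; apply/(facet_apexP _ hp); exists i.
Qed.

(** Replaces the intermediate facet by one coordinate of constant absolute value 1: a face of the
    cube that lies inside a facet is already a face of that facet. *)
Lemma front_complexP (R : realType) (m : nat) (tau : {set 'I_m + 'I_m})
    (Q : set 'rV[R]_m) : antipode_free tau ->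
  front_complex R tau Q <->
  is_face (cube_of R tau) Q /\ exists i, forall x, Q x -> `|x ord0 i| = 1.
Proof.
move=> hp; split.
- move=> [F [Ff Fa FQ]].
  have /(facet_apexP _ hp)[i it FE] := conj Ff Fa; split; last first.
    by exists i => x /(is_face_sub FQ); rewrite FE => -[].
  have [Fc _ _] := Ff; move: Fc; rewrite cube_of_box// => Fc.
  by apply: is_face_box_trans Fc FQ => j; apply: cube_lo_le_hi.
- move=> [Qf [i Qi]]; have [[x Qx] _] := Qf.
  have it := cube_norm1_supported hp (is_face_sub Qf Qx) (Qi _ Qx).
  have [Fa FA] : is_facet (cube_of R tau) (cube_facet R tau i) /\
      cube_facet R tau i (apex R tau) by apply/(facet_apexP _ hp); exists i.
  exists (cube_facet R tau i); split=> //.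
  have /(is_face_cubeP _ hp)[a [b [QE sd]]] := Qf.
  have ab j : a j <= b j.
    by have [] := side_le (cube_lo_le_hi R tau j) (sd j).
  rewrite cube_facet_box//; apply/is_face_box => [j|].
    by case: ifP => // _; apply: cube_lo_le_hi.
  exists a, b; split=> // j; have [->|//] := eqVneq j i.
  move: Qi; rewrite QE => Qi.
  (* Both extreme corners of [Q] have absolute value 1 in coordinate [i], which excludes the sides
     that reach 0. *)
  have := Qi _ (box_lo ab); have := Qi _ (box_hi ab); rewrite !mxE.
  move: (hp i) it (sd i); rewrite /cube_lo /cube_hi; move: (a i) (b i) => u v.
  by case: ifP => _; case: ifP => _ //= _ _; case=> //=;
    rewrite ?normr0 ?add0r ?addr0 => h1 h2;
    first [constructor|by exfalso; move: h1 h2; clear; lra].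
Qed.

Definition Zbd (R : realType) (m : nat) (K : {set {set 'I_m}}) : set 'rV[R]_m :=
  [set x | [/\ supp x \in Bier K, (forall i, `|x ord0 i| <= 1) &
               exists i, `|x ord0 i| = 1]].
Arguments Zbd R {m} K.

Lemma Zbd_fronts (R : realType) (m : nat) (K : {set {set 'I_m}}) :
  simplicial_complex K ->
  Zbd R K = \bigcup_(tau in [set tau | tau \in Bier K]) Front R tau.
Proof.
move=> hK; apply/seteqP; split=> x /=.
- move=> [xB x1 xi]; exists (supp x) => //; have hp := antipode_free_supp x.
  by rewrite FrontE// cube_ofE.
- move=> [tau /= tB]; have /BierP[_ _ hp] := tB; rewrite FrontE// cube_ofE//=.
  by move=> [[st ?] ?]; split=> //; apply: Bier_sub hK tB st.
Qed.

Lemma grid_subcomplex_Zbd (R : realType) (m : nat) (K : {set {set 'I_m}}) :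
  simplicial_complex K ->
  grid_subcomplex (Zbd R K) =
  [set Q | exists2 tau, tau \in Bier K & front_complex R tau Q].
Proof.
move=> hK; apply/seteqP; split=> Q /=.
- move=> [gQ QZ]; have : grid_subcomplex (Zset R K) Q.
    by split=> // x /QZ[xB x1 _]; rewrite ZsetE.
  rewrite grid_subcomplex_Zset// => -[tau /= tB Qt]; exists tau => //.
  have /BierP[_ _ hp] := tB; apply/(front_complexP _ hp); split=> //.
  move: gQ QZ => /grid_cellE[a [b [-> ab]]] QZ.
  have leab i := grid_side_le (ab i).
  (* A nondegenerate grid side has midpoint 1/2 or -1/2, so a coordinate of absolute value 1 at the
     midpoint belongs to a side that is a single point, and it is constant on the cell. *)
  have [_ _ [i]] := QZ _ (box_midpoint leab); rewrite mxE => mid1.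
  have norm1 (y : R) : `|y| = 1 <-> y = 1 \/ y = -1.
    split=> [|[->|->]]; rewrite ?normrN ?normr1//.
    by case: (ger0P y) => _ ?; [left|right]; lra.
  exists i => x /(_ i); rewrite norm1; move: mid1; rewrite norm1.
  by case: (ab i) => -[] ? ?; first [by left; lra|by right; lra|by exfalso; lra].
- move=> [tau tB Qt]; have /BierP[_ _ hp] := tB.
  have /(front_complexP _ hp)[Qf [i Qi]] := Qt; split.
    exact: face_cube_grid Qf.
  move=> x Qx; rewrite Zbd_fronts//; exists tau => //; rewrite FrontE//; split.
    exact: is_face_sub Qf _ Qx.
  by exists i; apply: Qi.
Qed.

Lemma cubulation_Zset (R : realType) (m : nat) (K : {set {set 'I_m}}) :
  simplicial_complex K -> cubulation (grid_subcomplex (Zset R K)) (Zset R K).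
Proof.
move=> hK; split; first exact: cubical_grid_subcomplex.
apply/seteqP; split=> x /=; first by move=> [Q [_ QZ] /QZ].
rewrite {1}Zset_cubes// => -[tau tB xt]; exists (cube_of R tau) => //.
rewrite grid_subcomplex_Zset//; exists tau => //.
have /BierP[_ _ hp] := tB; rewrite cube_of_box//.
by apply: is_face_box_refl => i; apply: cube_lo_le_hi.
Qed.

Lemma cubulation_Zbd (R : realType) (m : nat) (K : {set {set 'I_m}}) :
  simplicial_complex K -> cubulation (grid_subcomplex (Zbd R K)) (Zbd R K).
Proof.
move=> hK; split; first exact: cubical_grid_subcomplex.
apply/seteqP; split=> x /=; first by move=> [Q [_ QZ] /QZ].
rewrite {1}Zbd_fronts// => -[tau tB]; have /BierP[_ _ hp] := tB.
rewrite FrontE// => -[xt [i xi]]; exists (cube_facet R tau i) => //.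
rewrite grid_subcomplex_Zbd//; exists tau => //; apply/(front_complexP _ hp).
split; last by exists i => y [].
by apply: cube_facet_face => //; apply: cube_norm1_supported xt xi.
Qed.

(** * The map i_c *)

(** For [c] the absolute values of the coordinates of x, the value at level [c i] is the absolute
    value of coordinate [i] of i_c(x). *)
Definition cap_sum (R : realType) (m : nat) (c : 'I_m -> R) (t : R) : R :=
  \sum_j Num.min t (c j).

(* The closed form of i_c: in a simplex of the barycentric subdivision the
   absolute values of the coordinates are linearly ordered, hence each minimum
   is one of them.  Clamping x_i to [-|x_j|, |x_j|] is sgn(x_i) min(|x_i|, |x_j|). *)
Definition frontal (R : realType) (m : nat) (x : 'rV[R]_m) : 'rV[R]_m :=
  \row_i \sum_j Num.max (- `|x ord0 j|) (Num.min (x ord0 i) `|x ord0 j|).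

Lemma frontalE (R : realType) (m : nat) (x : 'rV[R]_m) i :
  frontal x ord0 i =
  Num.sg (x ord0 i) * cap_sum (fun j => `|x ord0 j|) `|x ord0 i|.
Proof.
rewrite mxE mulr_sumr; apply: eq_bigr => j _.
have := normr_ge0 (x ord0 j); move: (`|x ord0 j|) => u u0.
have [x0|x0|->] := ltgtP (x ord0 i) 0.
- rewrite ltr0_sg// ltr0_norm// /Num.min /Num.max.
  by case: (ltP (x ord0 i) u) => ?; repeat (case: ltP => ?); lra.
- rewrite gtr0_sg// gtr0_norm// /Num.min /Num.max.
  by case: (ltP (x ord0 i) u) => ?; repeat (case: ltP => ?); lra.
- rewrite sgr0 mul0r /Num.min /Num.max.
  by case: (ltP 0 u) => ?; repeat (case: ltP => ?); lra.
Qed.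

Lemma cap_sum_ge (R : realType) (m : nat) (c : 'I_m -> R) i :
  (forall j, 0 <= c j) -> c i <= cap_sum c (c i).
Proof.
move=> c0; rewrite /cap_sum (bigD1 i)//= minxx lerDl sumr_ge0// => j _.
by rewrite le_min !c0.
Qed.

Lemma cap_sum0 (R : realType) (m : nat) (c : 'I_m -> R) :
  (forall j, 0 <= c j) -> cap_sum c 0 = 0.
Proof. by move=> c0; rewrite /cap_sum big1// => j _; rewrite min_l. Qed.

Lemma cap_sum_le (R : realType) (m : nat) (c : 'I_m -> R) s t :
  s <= t -> cap_sum c s <= cap_sum c t.
Proof. by move=> st; apply: ler_sum => j _; rewrite le_min !ge_min st lexx orbT. Qed.

(** Term [i] grows strictly up to level [c i], and no other term decreases. *)
Lemma cap_sum_lt (R : realType) (m : nat) (c : 'I_m -> R) i t :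
  t < c i -> cap_sum c t < cap_sum c (c i).
Proof.
move=> tc; rewrite /cap_sum (bigD1 i)//= [ltRHS](bigD1 i)//= minxx.
rewrite ltr_leD//; first by rewrite min_l// ltW.
by apply: ler_sum => j _; rewrite le_min !ge_min (ltW tc) lexx orbT.
Qed.

(* The order of the values c_i is that of the values of [cap_sum], and on the
   first i where c and c' differ the equation is linear in c_i. *)
Lemma cap_sum_inj (R : realType) (m : nat) (c c' : 'I_m -> R) :
  (forall i, cap_sum c (c i) = cap_sum c' (c' i)) -> c =1 c'.
Proof.
move=> E; have ord (b : 'I_m -> R) i j :
    (cap_sum b (b i) <= cap_sum b (b j)) = (b i <= b j).
  apply/idP/idP; last exact: cap_sum_le.
  by rewrite [in X in _ -> X]leNgt => h; apply/negP => /cap_sum_lt; rewrite ltNge h.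
move=> i0; apply/eqP/negPn/negP => ne0.
pose P i := c i != c' i; have P0 : P i0 by [].
case: (@Order.TotalTheory.arg_minP _ _ _ i0 P (fun i => cap_sum c (c i)) P0) => s Ps smin.
have diff j : Num.min (c s) (c j) - Num.min (c' s) (c' j) =
    if c s <= c j then c s - c' s else 0.
  have cc' : (c s <= c j) = (c' s <= c' j) by rewrite -ord -[in RHS]ord !E.
  case: ifP => csj; first by rewrite !min_l// -cc'.
  have lt_js : c j < c s by rewrite ltNge csj.
  have lt_js' : c' j < c' s by rewrite ltNge -cc' csj.
  rewrite (min_r (ltW lt_js)) (min_r (ltW lt_js')).
  have /eqP -> : c j == c' j.
    apply/negPn/negP => Pj; have := smin _ Pj; rewrite leNgt.
    by rewrite (cap_sum_lt lt_js).
  by rewrite subrr.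
have := E s; move/eqP; rewrite -subr_eq0 /cap_sum -sumrB (eq_bigr _ (fun j _ => diff j)).
rewrite -big_mkcond sumr_const; rewrite -mulr_natr mulf_eq0 subr_eq0 (negPf Ps)/=.
rewrite pnatr_eq0; apply/negP; rewrite -lt0n; apply/card_gt0P; exists s.
exact: lexx.
Qed.

(* Peels off the lowest level set of d. *)
Lemma cap_sum_surj (R : realType) (m : nat) (d : 'I_m -> R) :
  (forall i, 0 <= d i) ->
  exists c : 'I_m -> R, (forall i, 0 <= c i) /\ forall i, cap_sum c (c i) = d i.
Proof.
move: {2}#|_|.+1 (ltnSn #|[set i | 0 < d i]%SET|) => n; elim: n d => // n IH d dn d0.
have [S0|/set0Pn[i0]] := eqVneq [set i | 0 < d i]%SET finset.set0.
  exists (fun=> 0); split=> // i; rewrite cap_sum0//.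
  apply/esym/le_anti; rewrite d0 andbT leNgt; apply/negP => di.
  have : i \in [set i | 0 < d i]%SET by rewrite inE.
  by rewrite S0 inE.
rewrite inE => di0; set S := [set i | 0 < d i]%SET in dn *.
have PS0 : i0 \in S by rewrite inE.
case: (@Order.TotalTheory.arg_minP _ _ _ i0 (fun i => i \in S) d PS0) => s sS smin.
pose d' (i : 'I_m) : R := if i \in S then d i - d s else 0.
have d'0 i : 0 <= d' i by rewrite /d'; case: ifP => // iS; rewrite subr_ge0 smin.
have lt_card : (#|[set i | (0 < d' i)%R]%SET| < n)%N.
  apply: (@leq_trans #|S|); last by rewrite -ltnS.
  apply: proper_card; apply/properP; split.
    by apply/fintype.subsetP => i; rewrite inE /d'; case: ifP => //; rewrite ltxx.
  by exists s => //; rewrite inE /d' sS subrr ltxx.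
have [c' [c'0 c'E]] := IH d' lt_card d'0.
have c'S i : i \notin S -> c' i = 0.
  move=> iS; apply/le_anti; rewrite c'0 andbT (le_trans (cap_sum_ge i c'0))//.
  by rewrite c'E /d' (negPf iS).
have S_gt0 : (0 < #|S|)%N by apply/card_gt0P; exists s.
(* Raising [c'] by [e] on [S] shifts each truncation between members of [S] by [e], which adds #|S|
   e = d s to the sum. Terms from outside [S] stay 0. *)
pose e := d s / #|S|%:R.
have e_gt0 : 0 < e by rewrite divr_gt0 ?ltr0n//; move: sS; rewrite inE.
exists (fun i => if i \in S then c' i + e else 0); split.
  by move=> i; case: ifP => // _; rewrite addr_ge0// ltW.
move=> i; case: ifP => iS; last first.
  rewrite cap_sum0; last by move=> j; case: ifP => // _; rewrite addr_ge0// ltW.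
  apply/le_anti; rewrite d0 /= leNgt; apply/negP => di.
  by move: iS; rewrite inE di.
have -> : d i = d' i + d s by rewrite /d' iS subrK.
rewrite -c'E /cap_sum.
have -> : d s = \sum_(j in S) e.
  by rewrite sumr_const /e -[_ *+ #|S|]mulr_natr divfK// pnatr_eq0 -lt0n.
rewrite [\sum_(j in S) e]big_mkcond -big_split/=; apply: eq_bigr => j _.
rewrite ?iS; case: ifP => [jS|/negbT jS]; first by rewrite -addr_minl.
by rewrite (c'S j jS) addr0 !min_r ?addr_ge0// ltW.
Qed.

(** * Signs, norms and bijectivity of the closed form of i_c *)

Section FrontalMap.
Context (R : realType) (m : nat).
Implicit Types (x y : 'rV[R]_m) (tau : {set 'I_m + 'I_m}).

Lemma normr_frontal x i :
  `|frontal x ord0 i| = cap_sum (fun j => `|x ord0 j|) `|x ord0 i|.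
Proof.
have n0 j : 0 <= `|x ord0 j| by [].
rewrite frontalE normrM (ger0_norm (le_trans (n0 i) (cap_sum_ge i n0))).
have [->|xi] := eqVneq (x ord0 i) 0; first by rewrite normr0 cap_sum0// mulr0.
by rewrite normr_sg xi mul1r.
Qed.

Lemma sgr_frontal x i : Num.sg (frontal x ord0 i) = Num.sg (x ord0 i).
Proof.
have n0 j : 0 <= `|x ord0 j| by [].
rewrite frontalE sgrM sgr_id.
have [->|xi] := eqVneq (x ord0 i) 0; first by rewrite sgr0 mul0r.
rewrite [X in _ * X]gtr0_sg ?mulr1//.
by apply: lt_le_trans (cap_sum_ge i n0); rewrite normr_gt0.
Qed.

Lemma supp_sgr x y :
  (forall i, Num.sg (x ord0 i) = Num.sg (y ord0 i)) -> supp x = supp y.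
Proof.
move=> E; apply/setP => -[i|i]; rewrite !inE.
  by rewrite -sgr_gt0 E sgr_gt0.
by rewrite -sgr_lt0 E sgr_lt0.
Qed.

Lemma supp_frontal x : supp (frontal x) = supp x.
Proof. by apply: supp_sgr => i; apply: sgr_frontal. Qed.

Lemma frontal_inj : injective (@frontal R m).
Proof.
move=> x y E; have norm_xy : (fun i => `|x ord0 i|) =1 (fun i => `|y ord0 i|).
  by apply: cap_sum_inj => i; rewrite -!normr_frontal E.
apply/rowP => i; have := sgr_frontal x i; rewrite E sgr_frontal => sxy.
by rewrite [LHS]numEsg [RHS]numEsg sxy norm_xy.
Qed.

Lemma frontal_surj y : exists x, frontal x = y.
Proof.
have [c [c0 cE]] := @cap_sum_surj R m (fun i => `|y ord0 i|) (fun i => normr_ge0 _).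
(* Needed so that multiplying [c] by the signs of [y] does not change its absolute values. *)
have c_eq0 i : y ord0 i = 0 -> c i = 0.
  move=> yi; apply/le_anti; rewrite c0 andbT (le_trans (cap_sum_ge i c0))//.
  by rewrite cE yi normr0.
pose x : 'rV[R]_m := \row_i (Num.sg (y ord0 i) * c i).
have xc i : `|x ord0 i| = c i.
  rewrite mxE normrM normr_sg; have [/c_eq0->|_] := eqVneq (y ord0 i) 0.
    by rewrite mul0r.
  by rewrite mul1r ger0_norm.
exists x; apply/rowP => i; rewrite [RHS]numEsg.
rewrite [LHS]numEsg normr_frontal sgr_frontal xc.
rewrite (_ : (fun j => _) = c) ?cE; last by apply/funext.
have [yi|yi] := eqVneq (y ord0 i) 0; first by rewrite yi normr0 !mulr0.
congr (_ * _); rewrite mxE sgrM sgr_id [X in _ * X]gtr0_sg ?mulr1//.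
rewrite lt_def c0 andbT; apply: contra_neq yi => ci.
by apply/eqP; rewrite -normr_eq0 -cE ci cap_sum0.
Qed.

(** At a coordinate of largest absolute value no term is truncated, so the image there has absolute
    value |x|_1, and it is at most this elsewhere. Thus i_c turns the 1-norm into the max norm. *)
Lemma sum_norm1_frontal x : \sum_i `|x ord0 i| = 1 <->
  (forall i, `|frontal x ord0 i| <= 1) /\ exists i, `|frontal x ord0 i| = 1.
Proof.
have le_sum i : `|frontal x ord0 i| <= \sum_j `|x ord0 j|.
  by rewrite normr_frontal; apply: ler_sum => j _; rewrite ge_min lexx orbT.
have max_sum (i0 : 'I_m) : exists i, `|frontal x ord0 i| = \sum_j `|x ord0 j|.
  case: (@Order.TotalTheory.arg_maxP _ _ _ i0 xpredT (fun i => `|x ord0 i|) isT) => i _ imax.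
  exists i; rewrite normr_frontal; apply: eq_bigr => j _.
  by rewrite min_r//; apply: imax.
split=> [x1|[x1 [i xi]]].
- split=> [i|]; first by rewrite -x1.
  have [i0 _] : exists i0 : 'I_m, true.
    apply: contrapT => N; move: x1; rewrite big1 => [/esym/eqP|i]; first by rewrite oner_eq0.
    by case: N; exists i.
  by have [i xi] := max_sum i0; exists i; rewrite xi.
- have [j xj] := max_sum i; apply/le_anti; rewrite -{1}xj x1 /= -xi.
  exact: le_sum.
Qed.

Lemma barycenterE tau i : antipode_free tau ->
  barycenter R tau ord0 i = #|tau|%:R^-1 *
    ((if inl i \in tau then 1 else 0) - (if inr i \in tau then 1 else 0)).
Proof.
move=> hp; rewrite mxE; congr (_ * _).
rewrite (eq_bigr (fun s => 1 *: vtx R s)) => [|s _]; last by rewrite scale1r.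
by rewrite comb_vtxE.
Qed.

Lemma barycenter_in_hull tau : tau != finset.set0 ->
  hull tau (@vtx R m) (barycenter R tau).
Proof.
move=> t0; have t_gt0 : (0 < #|tau|)%N by rewrite card_gt0.
exists (fun=> #|tau|%:R^-1); last by rewrite /barycenter scaler_sumr.
split=> [*|]; first by rewrite invr_ge0 ler0n.
by rewrite sumr_const -[LHS]mulr_natr mulVf// pnatr_eq0 -lt0n.
Qed.

Lemma frontal_barycenter tau : antipode_free tau -> tau != finset.set0 ->
  frontal (barycenter R tau) = apex R tau.
Proof.
move=> hp t0; have t_gt0 : (0 < #|tau|)%N by rewrite card_gt0.
have := barycenter_in_hull t0; rewrite hull_vtxE//= => -[_ sum1].
apply/rowP => i; rewrite frontalE apexE.
have [b0|bi] := eqVneq (barycenter R tau ord0 i) 0.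
  rewrite b0 sgr0 mul0r; move: b0 (hp i); rewrite barycenterE// /cube_lo /cube_hi.
  move/eqP; rewrite mulf_eq0 invr_eq0 pnatr_eq0 eqn0Ngt t_gt0 /=.
  by case: ifP => _; case: ifP => _ //=; rewrite ?addr0 ?subr0 ?sub0r ?oppr_eq0 ?oner_eq0.
(* The nonzero coordinates of a barycenter have equal absolute values, so nothing is truncated and
   the sum is the 1-norm. *)
have -> : cap_sum (fun j => `|barycenter R tau ord0 j|) `|barycenter R tau ord0 i| = 1.
  rewrite -sum1; apply: eq_bigr => j _; rewrite min_r//.
  move: bi (hp i) (hp j); rewrite !barycenterE// !normrM.
  rewrite mulf_eq0 invr_eq0 pnatr_eq0 eqn0Ngt t_gt0 /= => bi hi hj.
  rewrite ler_wpM2l//; move: bi hi hj.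
  by do 4 case: ifP => _ //=;
    rewrite ?subrr ?subr0 ?sub0r ?normrN ?normr0 ?normr1 ?lexx ?ler01 ?eqxx.
rewrite mulr1; move: bi (hp i); rewrite barycenterE// /cube_lo /cube_hi sgrM.
rewrite [Num.sg _^-1]gtr0_sg ?invr_gt0 ?ltr0n// mul1r.
by case: ifP => _; case: ifP => _ //=;
  rewrite ?subrr ?mulr0 ?eqxx// ?addr0 ?add0r ?oppr0 ?addr0 ?sgrN ?sgr1.
Qed.

End FrontalMap.

(** * Convex hulls of indexed points *)

Section Hull.
Context (R : realType) (m : nat) (T : finType).
Implicit Types (A B : {set T}) (p : T -> 'rV[R]_m).

Lemma hull_convex A p x y t : hull A p x -> hull A p y -> 0 <= t <= 1 ->
  hull A p ((1 - t) *: x + t *: y).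
Proof.
move=> [c [c0 c1] <-] [d [d0 d1] <-] /andP[t0 t1].
exists (fun s => (1 - t) * c s + t * d s).
  split=> [s sA|]; first by rewrite addr_ge0 ?mulr_ge0 ?c0 ?d0 ?subr_ge0.
  by rewrite big_split/= -!mulr_sumr c1 d1 !mulr1 subrK.
by rewrite !scaler_sumr -big_split/=; apply: eq_bigr => s _; rewrite !scalerA -scalerDl.
Qed.

Lemma hull_sub A B p : A \subset B -> hull A p `<=` hull B p.
Proof.
move=> AB x [c [c0 c1] <-]; exists (fun s => if s \in A then c s else 0).
  split=> [s _|]; first by case: ifP => // /c0.
  rewrite -c1 [LHS]big_mkcond [RHS]big_mkcond; apply: eq_bigr => s _.
  by case: (boolP (s \in A)) => [/(fintype.subsetP AB)->//|_]; rewrite if_same.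
rewrite [LHS]big_mkcond [RHS]big_mkcond; apply: eq_bigr => s _.
case: (boolP (s \in A)) => [/(fintype.subsetP AB)->//|_].
by rewrite scale0r if_same.
Qed.

Lemma hull_vertex A p s : s \in A -> hull A p (p s).
Proof.
move=> sA; exists (fun r => (r == s)%:R).
  split=> [r _|]; first exact: ler0n.
  by rewrite (bigD1 s)//= eqxx big1 ?addr0// => r /andP[_ /negPf->].
rewrite (bigD1 s)//= eqxx scale1r big1 ?addr0// => r /andP[_ /negPf->].
by rewrite scale0r.
Qed.

End Hull.

(** * Affinity of i_c on flags, and its uniqueness *)

Section FrontalAffine.
Context (R : realType) (m : nat) (tau : {set 'I_m + 'I_m}).
Hypothesis hp : antipode_free tau.
Implicit Types (x y : 'rV[R]_m) (c : {set {set 'I_m + 'I_m}}).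

(** The sign and the vertex through which index [i] enters [tau]. An index absent from [tau] gets
    the default -1 and [inr i], which is consistent because [inr i] then lies in no face of [tau]
    and the coordinate is 0. *)
Let sgn i : R := if inl i \in tau then 1 else -1.
Let ver i : 'I_m + 'I_m := if inl i \in tau then inl i else inr i.

(** Up to a fixed sign, a coordinate is the total weight of the flag members containing its vertex,
    so absolute values can be compared by comparing sets of members. The weights absorb the factors
    1/|I| of the barycenters. *)
Lemma flag_hull_coord c x : flag tau c -> hull c (@barycenter R m) x ->
  exists l : {set 'I_m + 'I_m} -> R,
    (forall I, I \in c -> 0 <= l I) /\
    forall i, x ord0 i = sgn i * \sum_(I in c | ver i \in I) l I.
Proof.
move=> [cS _] [l [l0 _] <-]; exists (fun I => l I / #|I|%:R); split.
  by move=> I Ic; rewrite divr_ge0 ?l0.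
move=> i; rewrite summxE mulr_sumr big_mkcondr; apply: eq_bigr => I Ic.
have [_ It] := cS I Ic; have /fintype.subsetP Is := It.
rewrite mxE barycenterE; last exact: antipode_free_sub hp It.
have := hp i; have := Is (inl i); have := Is (inr i); rewrite /sgn /ver.
case: (inl i \in tau) => /= ir il nir.
  have /negPf -> : inr i \notin I by apply: contra nir.
  by case: (inl i \in I) => /=; rewrite ?subrr ?subr0 ?mulr0// mulr1 mul1r.
have /negPf -> : inl i \notin I by apply/negP => /il.
by case: (inr i \in I) => /=; rewrite ?subrr ?mulr0// sub0r mulrN1 mulrN mulN1r.
Qed.

(** The members of a chain that contain a given vertex form an upper segment, and two upper segments
    of a chain are nested. *)
Lemma flag_comparable c s s' : flag tau c ->
  (forall I, I \in c -> s \in I -> s' \in I) \/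
  (forall I, I \in c -> s' \in I -> s \in I).
Proof.
move=> [_ chain].
have [/'forall_implyP h|] := boolP [forall I, (I \in c) ==> ((s \in I) ==> (s' \in I))].
  by left=> I /h/implyP.
rewrite negb_forall => /existsP[I]; rewrite !negb_imply => /and3P[Ic sI s'I].
right=> J Jc s'J; have /orP[/fintype.subsetP IJ|/fintype.subsetP JI] := chain _ _ Ic Jc.
  exact: IJ.
by rewrite JI // in s'I.
Qed.

(** The smaller of two absolute values has the same index throughout the hull of the flag, so [k]
    can be chosen before [x]. *)
Lemma frontal_flag_linear c : flag tau c ->
  exists k : 'I_m -> 'I_m -> 'I_m, forall x, hull c (@barycenter R m) x ->
    forall i, frontal x ord0 i =
              sgn i * \sum_j sgn (k i j) * x ord0 (k i j).
Proof.
move=> fc.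
have /choice[k kP] : forall ij : 'I_m * 'I_m, exists k : 'I_m,
    forall x, hull c (@barycenter R m) x ->
    Num.min `|x ord0 ij.1| `|x ord0 ij.2| = sgn k * x ord0 k.
  move=> [i j] /=.
  have sgn2 i' : sgn i' * sgn i' = 1.
    by rewrite /sgn; case: ifP => _; rewrite ?mulr1// mulrNN mulr1.
  have normE x i' l : (forall I, I \in c -> 0 <= l I) ->
      x ord0 i' = sgn i' * (\sum_(I in c | ver i' \in I) l I) ->
      `|x ord0 i'| = \sum_(I in c | ver i' \in I) l I.
    move=> l0 ->; rewrite normrM [X in _ * X]ger0_norm; last by apply: sumr_ge0 => I /andP[/l0].
    by rewrite /sgn; case: ifP => _; rewrite ?normrN normr1 mul1r.
  have le_sum l i1 i2 : (forall I, I \in c -> 0 <= l I) ->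
      (forall I, I \in c -> ver i1 \in I -> ver i2 \in I) ->
      \sum_(I in c | ver i1 \in I) l I <= \sum_(I in c | ver i2 \in I) l I :> R.
    move=> l0 h; rewrite big_mkcondr [leRHS]big_mkcondr; apply: ler_sum => I Ic.
    by case: ifP => [/(h _ Ic)->//|_]; case: ifP => // _; apply: l0.
  have [h|h] := flag_comparable (ver i) (ver j) fc.
    exists i => x /(flag_hull_coord fc)[l [l0 xE]].
    rewrite (normE _ _ _ l0 (xE i)) (normE _ _ _ l0 (xE j)) min_l ?le_sum//.
    by rewrite xE mulrA sgn2 mul1r.
  exists j => x /(flag_hull_coord fc)[l [l0 xE]].
  rewrite (normE _ _ _ l0 (xE i)) (normE _ _ _ l0 (xE j)) min_r ?le_sum//.
  by rewrite xE mulrA sgn2 mul1r.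
exists (fun i j => k (i, j)) => x xc i; rewrite frontalE.
have -> : cap_sum (fun j => `|x ord0 j|) `|x ord0 i| =
    \sum_j sgn (k (i, j)) * x ord0 (k (i, j)).
  by apply: eq_bigr => j _; rewrite -(kP (i, j)).
(* Here the sign of x_i is 0 whereas [sgn i] is not, but every minimum vanishes as well. *)
have [xi0|xi0] := eqVneq (x ord0 i) 0.
  rewrite xi0 sgr0 mul0r big1 ?mulr0// => j _.
  by rewrite -(kP (i, j))//= xi0 normr0 min_l.
congr (_ * _); have [l [l0 xE]] := flag_hull_coord fc xc.
have S0 : 0 <= \sum_(I in c | ver i \in I) l I by apply: sumr_ge0 => I /andP[/l0].
have S1 : \sum_(I in c | ver i \in I) l I != 0.
  by apply: contra_neq xi0; rewrite xE => ->; rewrite mulr0.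
rewrite xE sgrM [X in _ * X]gtr0_sg ?mulr1; last by rewrite lt_def S1.
by rewrite /sgn; case: ifP => _; rewrite ?sgrN sgr1.
Qed.

Lemma frontal_map_frontal : frontal_map tau (@frontal R m).
Proof.
split=> [I I0 It|c fc x y t xc yc t01].
  by apply: frontal_barycenter => //; apply: antipode_free_sub hp It.
have [k kE] := frontal_flag_linear fc; apply/rowP => i.
have rowE (u v : 'rV[R]_m) a b j :
  (a *: u + b *: v) ord0 j = a * u ord0 j + b * v ord0 j by rewrite !mxE.
rewrite rowE !kE//; last exact: hull_convex.
rewrite ![_ * (sgn i * _)]mulrCA -mulrDr; congr (_ * _).
rewrite !mulr_sumr -big_split/=; apply: eq_bigr => j _.
by rewrite rowE mulrDr; congr (_ + _); rewrite mulrCA.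
Qed.

Lemma supp_neq0 x : \sum_i `|x ord0 i| = 1 -> exists i, x ord0 i != 0.
Proof.
move=> x1; apply: contrapT => N; move: x1; rewrite big1 => [/esym/eqP|i _].
  by rewrite oner_eq0.
by apply/eqP; rewrite normr_eq0; apply/negPn/negP => xi; apply: N; exists i.
Qed.

Lemma barycenter_suppE x i :
  barycenter R (supp x) ord0 i = #|supp x|%:R^-1 * Num.sg (x ord0 i).
Proof.
rewrite barycenterE; last exact: antipode_free_supp.
by rewrite !inE; case: sgrP; rewrite ?subrr ?subr0 ?sub0r.
Qed.

(* Every point x of the simplex lies in a flag: moving away from the barycenter
   of its support until a coordinate of minimal absolute value vanishes gives a
   point x' of smaller support. *)
Lemma frontal_map_eq f g x : frontal_map tau f -> frontal_map tau g ->
  hull tau (@vtx R m) x -> f x = g x.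
Proof.
move=> [fb fa] [gb ga]; rewrite hull_vtxE//= => -[xt x1].
(* Keeping the flag inside the support of [x] lets the induction put a larger support on top of
   it. *)
suff [c []] : exists c, [/\ flag tau c, (forall I, I \in c -> I \subset supp x),
             hull c (@barycenter R m) x & f x = g x] by [].
move: {2}#|_|.+1 (ltnSn #|supp x|) xt x1 => n.
elim: n x => // n IH x xn xt x1; set S := supp x.
have [i0 xi0] := supp_neq0 x1.
case: (@Order.TotalTheory.arg_minP _ _ _ i0 (fun i => x ord0 i != 0)
  (fun i => `|x ord0 i|) xi0) => s xs smin.
pose v : 'I_m + 'I_m := if 0 < x ord0 s then inl s else inr s.
have vS : v \in S.
  rewrite /v; case: ifP => x0; rewrite inE//.
  by rewrite lt_neqAle xs leNgt x0.
have S0 : S != finset.set0 by apply/set0Pn; exists v.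
have k_gt0 : 0 < #|S|%:R :> R by rewrite ltr0n card_gt0.
have bS := barycenter_suppE x; set b := barycenter R (supp x) in bS.
have sum_sg : \sum_i `|Num.sg (x ord0 i)| = #|S|%:R.
  have := @barycenter_in_hull R m _ S0.
  rewrite hull_vtxE; last exact: antipode_free_supp.
  move=> [_]; rewrite (eq_bigr (fun i => #|S|%:R^-1 * `|Num.sg (x ord0 i)|)); last first.
    by move=> i _; rewrite bS normrM ger0_norm// invr_ge0 ltW.
  by rewrite -mulr_sumr => /(canRL (mulVKf (lt0r_neq0 k_gt0))); rewrite mulr1.
(* The nonzero coordinates of [b] have absolute value 1/#|S|, so subtracting [th] times [b] lowers
   every nonzero |x_i| by the minimum [t]. This removes [v] from the support. *)
pose t := `|x ord0 s|; pose th := #|S|%:R * t.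
have t_gt0 : 0 < t by rewrite normr_gt0.
have th_gt0 : 0 < th by rewrite mulr_gt0.
have le_t i : 0 <= `|x ord0 i| - t * `|Num.sg (x ord0 i)|.
  rewrite subr_ge0 normr_sg; have [->|xi] := eqVneq (x ord0 i) 0.
    by rewrite mulr0.
  by rewrite mulr1 smin.
have sumE : \sum_i (`|x ord0 i| - t * `|Num.sg (x ord0 i)|) = 1 - th.
  by rewrite sumrB x1 -mulr_sumr sum_sg mulrC.
have th_le1 : th <= 1 by rewrite -subr_ge0 -sumE sumr_ge0.
have fS : S \subset tau := xt.
have fgS : f b = g b by rewrite fb// gb.
have [xb|xb] := eqVneq x b.
  exists [set S]%SET; split.
  - split=> [I|I J]; rewrite !inE => /eqP->; first by [].
    by move=> /eqP->; rewrite subxx.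
  - by move=> I; rewrite inE => /eqP->.
  - by rewrite xb; apply: hull_vertex; rewrite inE.
  - by rewrite xb.
(* If [th] were 1, the lowered absolute values would sum to 0, so all nonzero |x_i| would be equal
   and [x] would be the barycenter. *)
have th_lt1 : 0 < 1 - th.
  rewrite subr_gt0 lt_neqAle th_le1 andbT; apply: contra_neq xb => th1.
  have Z i : `|x ord0 i| - t * `|Num.sg (x ord0 i)| = 0.
    have /psumr_eq0P : forall i, true -> 0 <= `|x ord0 i| - t * `|Num.sg (x ord0 i)| by [].
    by rewrite sumE th1 subrr => /(_ erefl i isT).
  have tk : t = #|S|%:R^-1.
    by apply: (mulfI (lt0r_neq0 k_gt0)); rewrite -/th th1 divff ?lt0r_neq0.
  apply/rowP => i; rewrite bS -tk [LHS]numEsg; have := Z i.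
  move/eqP; rewrite subr_eq0 => /eqP ->; rewrite normr_sg.
  by have [->|] := eqVneq (x ord0 i) 0; rewrite ?sgr0 ?mul0r ?mulr0// mulr1 mulrC.
pose x' := (1 - th)^-1 *: (x - th *: b).
have x'E i : x' ord0 i = (1 - th)^-1 * (`|x ord0 i| - t * `|Num.sg (x ord0 i)|) *
    Num.sg (x ord0 i).
  have -> : x' ord0 i = (1 - th)^-1 * (x ord0 i - th * b ord0 i) by rewrite !mxE.
  have thk : th / #|S|%:R = t by rewrite /th mulrC mulKf ?lt0r_neq0.
  rewrite bS [th * _]mulrA thk -mulrA; congr (_ * _).
  rewrite {1}[x ord0 i]numEsg normr_sg.
  by have [->|] := eqVneq (x ord0 i) 0; rewrite ?sgr0 ?mul0r ?mulr0 ?subrr// mulr1 mulrBl mulrC.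
have n'E i : `|x' ord0 i| = (1 - th)^-1 * (`|x ord0 i| - t * `|Num.sg (x ord0 i)|).
  rewrite x'E normrM ger0_norm; last by rewrite mulr_ge0// invr_ge0 ltW.
  rewrite normr_sg; have [->|] := eqVneq (x ord0 i) 0; last by rewrite !mulr1.
  by rewrite normr0 !mulr0 subrr mulr0.
have x'S : supp x' \subset S.
  apply/supp_subP => i; rewrite !inE x'E; set a := _ * (_ - _).
  have a0 : 0 <= a by rewrite mulr_ge0// invr_ge0 ltW.
  have [x0|x0|->] := ltgtP (x ord0 i) 0; split=> //; rewrite ?sgr0 ?mulr0 ?ltxx//.
    by rewrite ltr0_sg// mulrN1 oppr_gt0 ltNge a0.
  by rewrite gtr0_sg// mulr1 ltNge a0.
have x'n : (#|supp x'| < n)%N.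
  apply: (@leq_trans #|S|); last by rewrite -ltnS.
  apply: proper_card; apply/properP; split=> //; exists v => //.
  have x's : x' ord0 s = 0 by rewrite x'E normr_sg xs mulr1 subrr mulr0 mul0r.
  by rewrite /v; case: ifP => _; rewrite inE x's ltxx.
have x'1 : \sum_i `|x' ord0 i| = 1.
  by rewrite (eq_bigr _ (fun i _ => n'E i)) -mulr_sumr sumE mulVf// lt0r_neq0.
have [c [[cS chain] cx hx' fg']] := IH x' x'n (fintype.subset_trans x'S xt) x'1.
have xE : x = (1 - th) *: x' + th *: b.
  by rewrite /x' scalerA divff ?lt0r_neq0// scale1r subrK.
pose c' := (S |: c)%SET.
have fc' : flag tau c'.
  split=> [I|I J]; rewrite !inE.
    by move=> /orP[/eqP->//|]; apply: cS.
  have cI L : L \in c -> L \subset S.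
    by move=> /cx Lx; apply: fintype.subset_trans Lx x'S.
  move=> /orP[/eqP->|Ic] /orP[/eqP->|Jc]; rewrite ?subxx ?cI ?orbT//.
  exact: chain.
have c'x' : hull c' (@barycenter R m) x'.
  by apply: hull_sub hx'; apply: finset.subsetUr.
have c'b : hull c' (@barycenter R m) b by apply: hull_vertex; rewrite !inE eqxx.
have th01 : 0 <= th <= 1 by rewrite ltW.
exists c'; split=> //.
- move=> I; rewrite !inE => /orP[/eqP->//|/cx Ix].
  exact: fintype.subset_trans Ix x'S.
- by rewrite xE; apply: hull_convex.
- by rewrite xE (fa _ fc')// (ga _ fc')// fg' fgS.
Qed.

End FrontalAffine.

Lemma canonical_map_frontal (R : realType) (m : nat) (K : {set {set 'I_m}}) :
  canonical_map K (@frontal R m).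
Proof. by move=> tau /BierP[_ _ hp]; apply: frontal_map_frontal. Qed.

Lemma canonical_map_eq (R : realType) (m : nat) (K : {set {set 'I_m}}) f x :
  canonical_map K f -> realization R (Bier K) x -> f x = frontal x.
Proof.
move=> fK [tau /= tB xt]; have /BierP[_ _ hp] := tB.
exact: (frontal_map_eq hp (fK _ tB) (@frontal_map_frontal R m tau hp) xt).
Qed.

Lemma frontal_hull (R : realType) (m : nat) (tau : {set 'I_m + 'I_m}) (x : 'rV[R]_m) :
  antipode_free tau -> hull tau (@vtx R m) x <-> Front R tau (frontal x).
Proof.
move=> hp; rewrite hull_vtxE// FrontE// cube_ofE//= supp_frontal.
split=> [[xt /sum_norm1_frontal[]]|[[xt x1] xi]]; first by [].
by split=> //; apply/sum_norm1_frontal.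
Qed.

Lemma frontal_realization (R : realType) (m : nat) (K : {set {set 'I_m}}) (x : 'rV[R]_m) :
  simplicial_complex K ->
  realization R (Bier K) x <-> Zbd R K (frontal x).
Proof.
move=> hK; rewrite realizationE// /Zbd/= supp_frontal.
split=> [[xt /sum_norm1_frontal[]]|[xt x1 xi]]; first by [].
by split=> //; apply/sum_norm1_frontal.
Qed.

(** * Topology of row vectors *)

Lemma continuous_sum (R : realType) (T : topologicalType) (I : finType)
    (f : I -> T -> R) :
  (forall i, continuous (f i)) -> continuous (fun x => \sum_i f i x).
Proof.
move=> fc x; rewrite /index_enum; elim: (locked_with _ _) => [|i s IH].
  rewrite (_ : (fun x => _) = fun=> 0); first exact: cvg_cst.
  by apply/funext => y; rewrite big_nil.
rewrite (_ : (fun x => _) = fun x => f i x + \sum_(i <- s) f i x); last first.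
  by apply/funext => y; rewrite big_cons.
exact: (cvgD (fc i x) IH).
Qed.

Lemma row_continuous (R : realType) (T : topologicalType) (m : nat)
    (f : T -> 'rV[R]_m) :
  (forall i, continuous (fun x => f x ord0 i)) -> continuous f.
Proof.
move=> fc x; apply/cvg_ballP => e e0.
have near_i : \forall y \near x, forall i, ball (f x ord0 i) e (f y ord0 i).
  by apply: filter_forall => i; apply: (cvg_ball (fc i x)).
by apply: filterS near_i => y fy; split=> // i j; rewrite (ord1 i).
Qed.

Lemma rV_norm_le (R : realType) (m : nat) (x : 'rV[R]_m) (e : R) : 0 <= e ->
  `|x| <= e <-> forall i, `|x ord0 i| <= e.
Proof.
move=> e0; rewrite [`|x|]mx_normrE; split=> [/bigmax_leP[_ h] i|h].
  exact: (h (ord0, i)).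
by apply/bigmax_leP; split=> // -[i j] _; rewrite (ord1 i); apply: h.
Qed.

Lemma rV_norm1P (R : realType) (m : nat) (x : 'rV[R]_m) :
  `|x| = 1 <-> (forall i, `|x ord0 i| <= 1) /\ exists i, `|x ord0 i| = 1.
Proof.
split=> [x1|[x1 [i xi]]].
  split; first by apply/rV_norm_le; rewrite ?x1.
  have : mx_norm x != 0 by rewrite -[mx_norm x]/(`|x|) x1 oner_eq0.
  move=> /mx_norm_neq0[[i j]]; rewrite (ord1 i) -[mx_norm x]/(`|x|) x1 => ->.
  by exists j.
apply/le_anti/andP; split; first exact/rV_norm_le.
by rewrite -xi; apply: (rV_norm_le _ _).1.
Qed.

Lemma compact_unit_box (R : realType) (m : nat) (A : set 'rV[R]_m) :
  closed A -> (forall x, A x -> forall i, `|x ord0 i| <= 1) -> compact A.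
Proof.
move=> Ac A1.
have boxc : compact [set x : 'rV[R]_m | forall i, [set` `[-1, 1]] (x ord0 i)].
  by apply: (@rV_compact R m (fun=> [set` `[-1, 1]])) => i; apply: segment_compact.
apply: subclosed_compact Ac boxc _ => x Ax i.
by have := A1 x Ax i; rewrite ler_norml /= in_itv.
Qed.

(** The preimage of a closed set under the inverse is the image of a compact set, hence closed in a
    Hausdorff space. *)
Lemma compact_homeo (X : ptopologicalType) (Y : topologicalType)
    (A : set X) (B : set Y) (f : X -> Y) :
  hausdorff_space Y -> compact A -> set_bij A B f ->
  {within A, continuous f} -> homeo_on A B f.
Proof.
move=> hY Ac fbij fc; have [fAB finj fsurj] := fbij; split=> //.
(* The inverse has to be total: off [B] it takes the value [point]. *)
have /choice[g gP] : forall y, exists x, B y -> A x /\ f x = y.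
  move=> y; have [By|nBy] := pselect (B y); last by exists point.
  by have [x Ax <-] := fsurj y By; exists x.
have gK x : A x -> g (f x) = x.
  move=> Ax; have [Ag fg] := gP _ (fAB _ Ax).
  by apply: finj; rewrite ?inE.
exists g; split=> //; apply/continuous_closedP => C Cc.
apply/closed_subspaceP; exists (f @` (A `&` C)).
  apply: compact_closed => //; apply: continuous_compact.
    by apply: continuous_subspaceW fc => x [].
  exact: compact_closedI.
apply/seteqP; split=> y /=.
  by move=> [[x [Ax Cx] <-] By]; split=> //; change (C (g (f x))); rewrite gK.
move=> [Cg By]; split=> //; have [Ag fg] := gP _ By.
by exists (g y).
Qed.

Lemma homeo_on_sub (X Y : topologicalType) (A A' : set X) (B B' : set Y) (f : X -> Y) :
  homeo_on A B f -> A' `<=` A -> f @` A' = B' -> homeo_on A' B' f.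
Proof.
move=> [[fAB finj fsurj] fc [g [gc gK]]] A'A fA'.
have B'B : B' `<=` B by rewrite -fA' => _ [x /A'A Ax <-]; apply: fAB.
split.
- split; [by move=> x A'x; rewrite -fA'; exists x| |by rewrite /set_surj fA'].
  by move=> x y /set_mem/A'A Ax /set_mem/A'A Ay; apply: finj; rewrite inE.
- exact: continuous_subspaceW fc.
- exists g; split; first exact: continuous_subspaceW gc.
  by move=> x /A'A; apply: gK.
Qed.

Lemma homeo_on_eq (X Y : topologicalType) (A : set X) (B : set Y) (f f' : X -> Y) :
  homeo_on A B f -> (forall x, A x -> f x = f' x) -> homeo_on A B f'.
Proof.
move=> [[fAB finj fsurj] fc [g [gc gK]]] ff'; split.
- split.
  + by move=> x Ax; rewrite -ff'//; apply: fAB.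
  + move=> x y Ax Ay; rewrite -!ff' ?inE//; [exact: finj| |]; exact: set_mem.
  + by move=> y /fsurj[x Ax <-]; exists x => //; rewrite ff'.
- by apply: subspace_eq_continuous fc => x /set_mem Ax; apply: ff'.
- by exists g; split=> // x Ax; rewrite -ff'//; apply: gK.
Qed.

(** The clamped form of the map is used because the sign function is discontinuous at 0. *)
Lemma frontal_continuous (R : realType) (m : nat) : continuous (@frontal R m).
Proof.
apply: row_continuous => i.
have -> : (fun x : 'rV[R]_m => frontal x ord0 i) = fun x => \sum_j
    Num.max (- `|x ord0 j|) (Num.min (x ord0 i) `|x ord0 j|).
  by apply/funext => x; rewrite mxE.
apply: continuous_sum => j x.
have nj : {for x, continuous (fun x : 'rV[R]_m => `|x ord0 j| : R^o)}.
  by apply: (@continuous_comp _ _ _ (fun x : 'rV[R]_m => x ord0 j) Num.norm);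
    [exact: coord_continuous|exact: norm_continuous].
apply: (@continuous_max R _ (fun x : 'rV[R]_m => - `|x ord0 j|)
  (fun x : 'rV[R]_m => Num.min (x ord0 i) `|x ord0 j|)).
  exact: (cvgN nj).
apply: (@continuous_min R _ (fun x : 'rV[R]_m => x ord0 i)
  (fun x : 'rV[R]_m => `|x ord0 j|)) => //.
exact: coord_continuous.
Qed.

(** * The fan of the Bier sphere and the disc *)

Section Threshold.
Context (R : realType) (n : nat) (K : {set {set 'I_n.+1}}).
Hypothesis hK : simplicial_complex K.
Hypothesis hK' : K <> [set: {set 'I_n.+1}]%SET.
Implicit Types (x y z : 'rV[R]_n.+1) (u : 'rV[R]_n) (t : R).

Lemma complex_setT : [set: 'I_n.+1]%SET \notin K.
Proof.
apply/negP => TK; apply: hK'; apply/setP => I; rewrite inE.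
exact: hK.2 TK (finset.subsetT I).
Qed.

Lemma Bier0 : finset.set0 \in Bier K.
Proof.
apply/BierP; split=> [||i]; rewrite ?inE//.
- by rewrite (_ : finset _ = finset.set0) ?hK.1//; apply/setP => i; rewrite !inE.
- rewrite (_ : (~: _)%SET = [set: 'I_n.+1]%SET) ?complex_setT//.
  by apply/setP => i; rewrite !inE.
Qed.

Lemma supp_shiftP y t : supp (y - const_mx t) \in Bier K <->
  [set i | t < y ord0 i]%SET \in K /\ [set i | t <= y ord0 i]%SET \notin K.
Proof.
have shE i : (y - const_mx t) ord0 i = y ord0 i - t by rewrite !mxE.
have posE : [set i | inl i \in supp (y - const_mx t)]%SET = [set i | t < y ord0 i]%SET.
  by apply/setP => i; rewrite !inE shE subr_gt0.
have negE : (~: [set i | inr i \in supp (y - const_mx t)])%SET = [set i | t <= y ord0 i]%SET.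
  by apply/setP => i; rewrite !inE shE subr_lt0 -leNgt.
split=> [/BierP[]|[h1 h2]]; first by rewrite posE inE negE.
by apply/BierP; split; rewrite ?posE// ?inE ?negE//; apply: antipode_free_supp.
Qed.

(** The threshold is the largest coordinate of [y] whose weak upper level set is not in K. Some
    coordinate qualifies, since the level set at the smallest one is all of [m]. *)
Lemma threshold_exists y : exists t, supp (y - const_mx t) \in Bier K.
Proof.
pose up t := [set i | t <= y ord0 i]%SET.
pose P (i : 'I_n.+1) := up (y ord0 i) \notin K.
have [i0 Pi0] : exists i0, P i0.
  case: (@Order.TotalTheory.arg_minP _ _ _ ord0 xpredT (fun i => y ord0 i) isT) => i _ imin.
  exists i; rewrite /P (_ : up _ = [set: 'I_n.+1]%SET) ?complex_setT//.
  by apply/setP => j; rewrite !inE; apply: imin.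
case: (@Order.TotalTheory.arg_maxP _ _ _ i0 P (fun i => y ord0 i) Pi0) => i Pi imax.
exists (y ord0 i); apply/supp_shiftP; split=> //.
set U := [set j | _]%SET.
have [->|/set0Pn[j0 j0U]] := eqVneq U finset.set0; first exact: hK.1.
case: (@Order.TotalTheory.arg_minP _ _ _ j0 (fun j => j \in U)
  (fun j => y ord0 j) j0U) => j jU jmin.
(* The strict upper level set is the weak one at the next larger coordinate, which is in K by
   maximality of y_i. *)
have -> : U = up (y ord0 j).
  apply/setP => k; rewrite [RHS]inE; apply/idP/idP; first exact: jmin.
  by move: jU; rewrite !inE; apply: lt_le_trans.
apply/negPn/negP => Pj; have : y ord0 j <= y ord0 i := imax _ Pj.
by rewrite leNgt; move: jU; rewrite inE => ->.
Qed.

(** If s + c < t, then {i : y_i >= t} is contained in {i : z_i > s}, although the latter is in K and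
    the former is not. Taking c = 0 gives uniqueness, and taking c = |y - z| gives the Lipschitz
    bound. *)
Lemma threshold_le y z (s t c : R) :
  supp (y - const_mx t) \in Bier K -> supp (z - const_mx s) \in Bier K ->
  (forall i, y ord0 i <= z ord0 i + c) -> t <= s + c.
Proof.
move=> /supp_shiftP[_ yt] /supp_shiftP[zs _] yz; rewrite leNgt; apply/negP => sct.
move/negP: yt; apply; apply: hK.2 zs _; apply/fintype.subsetP => i; rewrite !inE.
by have := yz i; lra.
Qed.

Definition threshold y : R := sval (cid (threshold_exists y)).

Lemma thresholdP y : supp (y - const_mx (threshold y)) \in Bier K.
Proof. exact: svalP (cid (threshold_exists y)). Qed.

Lemma threshold_eq y t : supp (y - const_mx t) \in Bier K -> threshold y = t.
Proof.
have le_y i : y ord0 i <= y ord0 i + 0 by rewrite addr0.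
move=> yt; apply/le_anti/andP; split; rewrite -[leRHS]addr0.
  exact: threshold_le (thresholdP y) yt le_y.
exact: threshold_le yt (thresholdP y) le_y.
Qed.

Lemma threshold_lip y z : `|threshold y - threshold z| <= `|y - z|.
Proof.
have coord (y' z' : 'rV[R]_n.+1) i : y' ord0 i <= z' ord0 i + `|y' - z'|.
  have := (rV_norm_le (y' - z') (normr_ge0 _)).1 (lexx _) i.
  by rewrite !mxE => /ler_normlW; lra.
have h1 := threshold_le (thresholdP y) (thresholdP z) (coord y z).
have h2 := threshold_le (thresholdP z) (thresholdP y) (coord z y).
by rewrite distrC in h2; rewrite ler_norml; lra.
Qed.

Lemma threshold_continuous : continuous threshold.
Proof.
move=> y; apply/(@cvgrPdist_lt _ _ _ _ (nbhs_filter y)) => e e0.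
have near_y : \forall z \near y, ball y e z by apply: nbhsx_ballx.
apply: filterS near_y => z; rewrite mx_norm_ball /ball_ /=.
exact: le_lt_trans (threshold_lip y z).
Qed.

Lemma supp_scale_sub (a : R) x : 0 <= a -> supp (a *: x) \subset supp x.
Proof.
move=> a0; apply/supp_subP => i; rewrite mxE !inE.
have [x0|x0|->] := ltgtP (x ord0 i) 0; split=> //; rewrite ?mulr0 ?ltxx//.
  by rewrite ltNge mulr_ge0_le0// ltW.
by rewrite ltNge mulr_ge0// ltW.
Qed.

Lemma Bier_scale (a : R) x : 0 <= a -> supp x \in Bier K ->
  supp (a *: x) \in Bier K.
Proof. by move=> a0 xB; apply: Bier_sub hK xB (supp_scale_sub x a0). Qed.

(* The polyhedral fan of the cones over the simplices of Bier(K) is a section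
   of the projection R^{n+1} -> R^{n+1} / (1, ..., 1), here identified with R^n
   by subtracting the coordinate of index 0. *)
Definition fan_proj x : 'rV[R]_n := \row_j (x ord0 (lift ord0 j) - x ord0 ord0).

Definition fan_pad u : 'rV[R]_n.+1 :=
  \row_i (if unlift ord0 i is Some j then u ord0 j else 0).

Definition fan_lift u : 'rV[R]_n.+1 :=
  fan_pad u - const_mx (threshold (fan_pad u)).

Lemma fan_liftP u : supp (fan_lift u) \in Bier K.
Proof. exact: thresholdP. Qed.

Lemma fan_liftK : cancel fan_lift fan_proj.
Proof. by move=> u; apply/rowP => j; rewrite !mxE liftK unlift_none; lra. Qed.

Lemma fan_projK x : supp x \in Bier K -> fan_lift (fan_proj x) = x.
Proof.
move=> xB; have padE : fan_pad (fan_proj x) = x - const_mx (x ord0 ord0).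
  apply/rowP => i; rewrite !mxE; case: unliftP => [j ->|->]; first by rewrite mxE.
  by rewrite subrr.
(* The padded projection is [x] translated by - x_0 (1, ..., 1). Undoing this translation lands in
   the fan, so the threshold is - x_0. *)
rewrite /fan_lift (@threshold_eq _ (- x ord0 ord0)).
  by apply/rowP => i; rewrite padE !mxE; lra.
rewrite (_ : _ - _ = x)//.
by apply/rowP => i; rewrite padE !mxE; lra.
Qed.

Lemma fan_projZ (a : R) x : fan_proj (a *: x) = a *: fan_proj x.
Proof. by apply/rowP => i; rewrite !mxE mulrBr. Qed.

Lemma fan_liftZ (a : R) x : 0 <= a -> supp x \in Bier K ->
  fan_lift (a *: fan_proj x) = a *: x.
Proof. by move=> a0 xB; rewrite -fan_projZ fan_projK// Bier_scale. Qed.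

Lemma fan_lift0 : fan_lift 0 = 0.
Proof.
have -> : 0 = fan_proj 0 :> 'rV[R]_n by apply/rowP => i; rewrite !mxE subrr.
rewrite fan_projK// (_ : supp 0 = finset.set0) ?Bier0//.
by apply/setP => -[i|i]; rewrite !inE mxE ltxx.
Qed.

Lemma fan_lift_eq0 u : (fan_lift u == 0) = (u == 0).
Proof.
apply/eqP/eqP => [u0|->]; last exact: fan_lift0.
by rewrite -(fan_liftK u) u0 -fan_lift0 fan_liftK.
Qed.

Lemma fan_lift_continuous : continuous fan_lift.
Proof.
have padc : continuous fan_pad.
  apply: row_continuous => i.
  have [[j uE]|uN] : (exists j, unlift ord0 i = Some j) \/ unlift ord0 i = None.
    by case: (unlift _ _) => [j|]; [left; exists j|right].
  - have -> : (fun u => fan_pad u ord0 i) = fun u => u ord0 j.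
      by apply/funext => u; rewrite mxE uE.
    exact: coord_continuous.
  - have -> : (fun u => fan_pad u ord0 i) = fun=> 0.
      by apply/funext => u; rewrite mxE uN.
    exact: cst_continuous.
apply: row_continuous => i.
have -> : (fun u => fan_lift u ord0 i) =
    fun u => fan_pad u ord0 i - threshold (fan_pad u).
  by apply/funext => u; rewrite /fan_lift !mxE.
move=> u.
have h1 := continuous_comp (padc u) (@coord_continuous R 1 n.+1 ord0 i (fan_pad u)).
have h2 := continuous_comp (padc u) (@threshold_continuous (fan_pad u)).
exact: (cvgB h1 h2).
Qed.

(** * Radial rescaling of the Euclidean ball onto the unit ball of the fan *)

Definition norm2 u : R := Num.sqrt (\sum_i u ord0 i ^+ 2).

Lemma norm2_ge0 u : 0 <= norm2 u. Proof. exact: sqrtr_ge0. Qed.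

Lemma norm2_eq0 u : (norm2 u == 0) = (u == 0).
Proof.
have s0 : forall i : 'I_n, true -> 0 <= u ord0 i ^+ 2 by move=> i _; apply: sqr_ge0.
apply/eqP/eqP => [u0|->].
  have S0 : 0 <= \sum_i u ord0 i ^+ 2 := sumr_ge0 _ s0.
  have S1 : \sum_i u ord0 i ^+ 2 = 0.
    by rewrite -(sqr_sqrtr S0) -/(norm2 u) u0 expr0n.
  apply/rowP => i; rewrite mxE; apply/eqP.
  by rewrite -sqrf_eq0; apply/eqP; apply: (psumr_eq0P s0 S1).
by rewrite /norm2 big1 ?sqrtr0// => i _; rewrite mxE expr0n.
Qed.

Lemma norm2Z (a : R) u : 0 <= a -> norm2 (a *: u) = a * norm2 u.
Proof.
move=> a0; rewrite /norm2 -[in RHS](ger0_norm a0) -sqrtr_sqr -sqrtrM ?sqr_ge0//.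
by congr Num.sqrt; rewrite mulr_sumr; apply: eq_bigr => i _; rewrite mxE exprMn.
Qed.

Lemma sum_sq_continuous : continuous (fun u => \sum_i u ord0 i ^+ 2).
Proof.
apply: continuous_sum => i u; have := @coord_continuous R 1 n ord0 i u => uc.
exact: (cvgM uc uc).
Qed.

Lemma norm2_continuous : continuous norm2.
Proof.
move=> u.
exact: continuous_comp (@sum_sq_continuous u) (@sqrt_continuous R _).
Qed.

(** The factor makes the max norm of the image equal to the Euclidean norm of [u]. At 0 the lift is
    0, so the value is 0 whatever the quotient. *)
Definition disc_map u : 'rV[R]_n.+1 := (norm2 u / `|fan_lift u|) *: fan_lift u.

Lemma norm_disc_map u : `|disc_map u| = norm2 u.
Proof.
rewrite normrZ normrM normfV normr_id (ger0_norm (norm2_ge0 u)).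
have [->|u0] := eqVneq u 0.
  have /eqP -> : norm2 0 == 0 by rewrite norm2_eq0.
  by rewrite !mul0r.
by rewrite divfK// normr_eq0 fan_lift_eq0.
Qed.

Lemma disc_map_Bier u : supp (disc_map u) \in Bier K.
Proof. by apply: Bier_scale (fan_liftP u); rewrite divr_ge0// norm2_ge0. Qed.

(** Away from 0 this is a quotient of continuous functions with nonzero denominator. At 0 it follows
    from [norm_disc_map], since the norm of the image is [norm2], which tends to 0. *)
Lemma disc_map_continuous : continuous disc_map.
Proof.
move=> u; rewrite /continuous_at; have [u0|u0] := eqVneq u 0.
  have -> : disc_map u = 0.
    by apply/eqP; rewrite -normr_eq0 norm_disc_map norm2_eq0 u0.
  have n0 : norm2 u = 0 by apply/eqP; rewrite norm2_eq0 u0.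
  have := @norm2_continuous u; rewrite /continuous_at n0 => nc.
  apply/(@norm_cvg0P _ _ _ _ (nbhs_filter u)).
  by have -> : (fun v => `|disc_map v|) = norm2
    by apply/funext => v; rewrite norm_disc_map.
have f0 : `|fan_lift u| != 0 by rewrite normr_eq0 fan_lift_eq0.
have nc := continuous_comp (@fan_lift_continuous u) (@norm_continuous _ _ (fan_lift u)).
exact: (cvgZ (cvgM (@norm2_continuous u) (cvgV f0 nc)) (@fan_lift_continuous u)).
Qed.

(** Equal images force equal Euclidean norms. After projection, positive multiples of [u] and [v]
    agree, and the equal norms then force equal factors. *)
Lemma disc_map_inj : injective disc_map.
Proof.
move=> u v E; have nE : norm2 u = norm2 v by rewrite -!norm_disc_map E.
have [u0|u0] := eqVneq u 0.
  by apply/esym/eqP; rewrite u0 -norm2_eq0 -nE norm2_eq0 u0.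
have v0 : v != 0 by rewrite -norm2_eq0 -nE norm2_eq0.
have := congr1 fan_proj E; rewrite !fan_projZ !fan_liftK => E'.
have pos w : w != 0 -> 0 < norm2 w / `|fan_lift w|.
  move=> w0; rewrite divr_gt0 ?normr_gt0 ?fan_lift_eq0//.
  by rewrite lt_def norm2_eq0 w0 norm2_ge0.
have := congr1 norm2 E'; rewrite !norm2Z ?ltW ?pos// nE => /mulIf E2.
move: E'; rewrite nE E2 ?norm2_eq0//; apply: scalerI.
by rewrite lt0r_neq0 ?pos.
Qed.

Lemma disc_map_surj x : supp x \in Bier K -> exists u, disc_map u = x.
Proof.
move=> xB; have [->|x0] := eqVneq x 0.
  by exists 0; apply/eqP; rewrite -normr_eq0 norm_disc_map norm2_eq0.
have px0 : norm2 (fan_proj x) != 0.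
  rewrite norm2_eq0; apply: contra x0 => /eqP p0.
  by rewrite -(fan_projK xB) p0 fan_lift0.
have nx0 : `|x| != 0 by rewrite normr_eq0.
(* Chosen so that the preimage has Euclidean norm |x|. *)
pose a := `|x| / norm2 (fan_proj x).
have a0 : 0 <= a by rewrite divr_ge0 ?norm2_ge0.
have a_neq0 : a != 0 by rewrite mulf_neq0 ?invr_eq0.
exists (a *: fan_proj x); rewrite /disc_map fan_liftZ// norm2Z// normrZ ger0_norm//.
rewrite scalerA {1}/a divfK// -[X in _ = X]scale1r; congr (_ *: _).
by rewrite mulrC mulrA divff// mulf_neq0.
Qed.

Lemma ZsetE_norm : Zset R K = [set x | supp x \in Bier K /\ `|x| <= 1].
Proof.
by rewrite ZsetE//; apply/seteqP; split=> x /= -[xB /rV_norm_le x1]; split=> //; apply: x1.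
Qed.

Lemma ZbdE_norm : Zbd R K = [set x | supp x \in Bier K /\ `|x| = 1].
Proof.
apply/seteqP; split=> x /= => [[xB x1 xi]|[xB /rV_norm1P[x1 xi]]]; split=> //.
exact/rV_norm1P.
Qed.

Lemma disc_with_boundary_Zset : disc_with_boundary n (Zset R K) (Zbd R K).
Proof.
have sum0 u : 0 <= \sum_i u ord0 i ^+ 2 by apply: sumr_ge0 => i _; apply: sqr_ge0.
have discE u : (\sum_i u ord0 i ^+ 2 <= 1) = (norm2 u <= 1).
  by rewrite -[X in _ = (_ <= X)]sqrtr1 ler_sqrt.
have sphereE u : \sum_i u ord0 i ^+ 2 = 1 <-> norm2 u = 1.
  split=> [S1|N1]; first by rewrite /norm2 S1 sqrtr1.
  by rewrite -(sqr_sqrtr (sum0 u)) -/(norm2 u) N1 expr1n.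
exists disc_map; split.
- apply: compact_homeo; first exact: norm_hausdorff.
  + apply: compact_unit_box => [|u /= u1 i].
      rewrite (_ : std_disc R n = (fun u => \sum_i u ord0 i ^+ 2) @^-1` [set r | r <= 1])//.
      by apply: (continuous_closedP _).1; [exact: sum_sq_continuous|exact: closed_le].
    (* One square is at most the sum of all, so the Euclidean ball lies in the unit box. *)
    rewrite -(@expr_le1 _ 2)// real_normK ?num_real//; apply: le_trans u1.
    by rewrite (bigD1 i)//= lerDl sumr_ge0// => j _; apply: sqr_ge0.
  + split=> [u /= u1|u v _ _|x /=]; rewrite ?ZsetE_norm /=.
    * by rewrite norm_disc_map -discE; split=> //; apply: disc_map_Bier.
    * exact: disc_map_inj.
    * move=> [xB x1]; have [u uE] := disc_map_surj xB; exists u => //=.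
      by rewrite /std_disc /= discE -norm_disc_map uE.
  + by apply: continuous_subspaceT; apply: disc_map_continuous.
- rewrite ZbdE_norm; apply/seteqP; split=> x /=.
    by move=> [u /sphereE u1 <-]; rewrite norm_disc_map; split=> //; apply: disc_map_Bier.
  move=> [xB x1]; have [u uE] := disc_map_surj xB; exists u => //=.
  by apply/sphereE; rewrite -norm_disc_map uE.
Qed.

(** The fan is the zero set of the continuous function [threshold], and the realization is its
    intersection with the closed unit sphere of the 1-norm. *)
Lemma closed_realization : closed (realization R (Bier K)).
Proof.
rewrite realizationE//.
have -> : [set x | supp x \in Bier K /\ \sum_i `|x ord0 i| = 1] =
    threshold @^-1` [set r | r = 0] `&`
    (fun x => \sum_i `|x ord0 i|) @^-1` [set r | r = 1].
  have c0 x : x - const_mx 0 = x by apply/rowP => i; rewrite !mxE subr0.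
  apply/seteqP; split=> x /= -[xB ?]; split=> //.
    by apply: threshold_eq; rewrite c0.
  by have := thresholdP x; rewrite xB c0.
apply: closedI; apply: (continuous_closedP _).1; try exact: closed_eq.
  exact: threshold_continuous.
apply: continuous_sum => i x.
apply: (@continuous_comp _ _ _ (fun x : 'rV[R]_n.+1 => x ord0 i) Num.norm).
  exact: coord_continuous.
exact: norm_continuous.
Qed.

Lemma homeo_frontal : homeo_on (realization R (Bier K)) (Zbd R K) (@frontal R n.+1).
Proof.
apply: compact_homeo; first exact: norm_hausdorff.
- apply: compact_unit_box; first exact: closed_realization.
  move=> x; rewrite realizationE// => -[_ <-] i.
  by rewrite (bigD1 i)//= lerDl sumr_ge0.
- split=> [x|x y _ _|y yZ].
  + by move=> /frontal_realization h; apply: h.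
  + exact: frontal_inj.
  + have [x xy] := frontal_surj y; exists x => //.
    by apply/frontal_realization; rewrite ?xy.
- by apply: continuous_subspaceT; apply: frontal_continuous.
Qed.

End Threshold.

Theorem proposition8p2 (R : realType) (m : nat) (K : {set {set 'I_m}})
    (hK : simplicial_complex K) (hK' : K <> [set: {set 'I_m}]%SET) :
  let Z := Zset R K in
  cubulation (grid_subcomplex Z) Z /\
  (* (i) *)
  (Z = \bigcup_(tau in [set tau | tau \in Bier K]) cube_of R tau /\
   grid_subcomplex Z =
     [set Q | exists2 tau, tau \in Bier K & is_face (cube_of R tau) Q]) /\
  exists dZ : set 'rV[R]_m,
    disc_with_boundary m.-1 Z dZ /\
    cubulation (grid_subcomplex dZ) dZ /\
    (* (ii) *)
    (dZ = \bigcup_(tau in [set tau | tau \in Bier K]) Front R tau /\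
     grid_subcomplex dZ =
       [set Q | exists2 tau, tau \in Bier K & front_complex R tau Q]) /\
    (exists ic : 'rV[R]_m -> 'rV[R]_m, canonical_map K ic) /\
    (forall ic : 'rV[R]_m -> 'rV[R]_m, canonical_map K ic ->
       [/\ homeo_on (realization R (Bier K)) dZ ic,
           (forall tau, tau \in Bier K ->
              homeo_on (hull tau (@vtx R m)) (Front R tau) ic) &
           [set ic @` P | P in canonical_cubulation K ic]
             = grid_subcomplex dZ]).
Proof.
case: m K hK hK' => [|n] K hK hK' /=.
  (* For m = 0 the only complex is the full power set, which is excluded. Hence m = n + 1, and the
     disc has dimension n. *)
  by case: hK'; apply/setP => I; rewrite inE; apply: hK.2 hK.1 _;
    apply/fintype.subsetP => -[].
split; first exact: cubulation_Zset.
split; first by split; [exact: Zset_cubes|exact: grid_subcomplex_Zset].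
exists (Zbd R K); split; first exact: disc_with_boundary_Zset.
split; first exact: cubulation_Zbd.
split; first by split; [exact: Zbd_fronts|exact: grid_subcomplex_Zbd].
split; first by exists (@frontal R n.+1); apply: canonical_map_frontal.
move=> ic icK.
(* Every map meeting the specification of i_c agrees with the closed form on the realization, so
   properties of the latter transfer. *)
have icE x : realization R (Bier K) x -> frontal x = ic x.
  by move=> /(canonical_map_eq icK).
have hull_real tau : tau \in Bier K -> hull tau (@vtx R n.+1) `<=` realization R (Bier K).
  by move=> tB x xt; exists tau.
have hull_Front tau : tau \in Bier K -> (@frontal R n.+1) @` hull tau (@vtx R n.+1) = Front R tau.
  move=> /BierP[_ _ hp]; apply/seteqP; split=> y.
    by move=> [x /(frontal_hull _ hp) xt <-].
  by have [x <-] := frontal_surj y => /(frontal_hull _ hp) xt; exists x.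
have homeo := @homeo_frontal R n K hK hK'.
(* Pulling a cell back and pushing it forward recovers it because it lies in the front, which is the
   image of the simplex. *)
have image_cell tau Q : tau \in Bier K -> front_complex R tau Q ->
    ic @` (hull tau (@vtx R n.+1) `&` ic @^-1` Q) = Q.
  move=> tB [F [Ff Fa FQ]]; apply/seteqP; split=> y /=; first by move=> [x [_ Qx] <-].
  move=> Qy; have : Front R tau y by exists F => //; apply: is_face_sub FQ _ Qy.
  rewrite -hull_Front// => -[x xt xy]; have icx : ic x = y.
    by rewrite -icE//; apply: hull_real xt.
  by exists x => //; split=> //; rewrite /preimage /= icx.
split.
- exact: homeo_on_eq homeo icE.
- move=> tau tB; apply: (@homeo_on_eq _ _ _ _ (@frontal R n.+1)).
    by apply: homeo_on_sub homeo _ _; [exact: hull_real|exact: hull_Front].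
  by move=> x /(hull_real _ tB); apply: icE.
- rewrite grid_subcomplex_Zbd//; apply/seteqP; split=> Q /=.
    by move=> [P [tau [Q' [tB Q'f ->]]] <-]; exists tau; rewrite ?image_cell.
  move=> [tau tB Qf]; exists (hull tau (@vtx R n.+1) `&` ic @^-1` Q).
    by exists tau, Q.
  exact: image_cell.
Qed.
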